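(* Let $(\Omega,\mathcal{F},\mu)$ be a probability space and let $T=\{T_x\}_{x\in\mathbb{R}}$ be a $1$-dimensional measure-preserving and ergodic dynamical system on $\Omega$. Let $a:\Omega\to\mathbb{R}$ be a measurable function for which there exist positive constants $\nu_1,\nu_2$ such that $\nu_1\le a(\omega)\le\nu_2$ for almost all $\omega\in\Omega$, and set $a_T(x,\omega)=a(T_x(\omega))$ for $x\in\mathbb{R}$, $\omega\in\Omega$. Then, for almost all $\omega\in\Omega$, the function $a_T(\cdot,\omega):\mathbb{R}\to\mathbb{R}$ admits homogenization, and the corresponding homogenized coefficient is $$a^0=\frac{1}{\mathbb{E}\{1/a\}},\qquad\text{where } \mathbb{E}\{1/a\}=\int_\Omega \frac{1}{a(\omega)}\,\mu(d\omega).$$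
   Context: **Dynamical systems.** Let $(\Omega,\mathcal{F},\mu)$ be a probability space. An $n$-dimensional measure-preserving dynamical system $T=\{T_x\}_{x\in\mathbb{R}^n}$ on $\Omega$ is a family of measurable maps $T_x:\Omega\to\Omega$ such that: (1) $T_{x+y}=T_x\circ T_y$ for all $x,y\in\mathbb{R}^n$; (2) $T_0$ is the identity map; (3) $\mu(T_x^{-1}(F))=\mu(F)$ for all $x\in\mathbb{R}^n$, $F\in\mathcal{F}$; (4) for every measurable $g:(\Omega,\mathcal{F})\to(X,\Sigma)$ into a measurable space, the map $(x,\omega)\mapsto g(T_x(\omega))$ on $\mathbb{R}^n\times\Omega$ is $(\mathcal{B}(\mathbb{R}^n)\otimes\mathcal{F})/\Sigma$-measurable. A set $E\in\mathcal{F}$ is $T$-invariant if $T_x^{-1}(E)=E$ for all $x\in\mathbb{R}^n$. $T$ is ergodic if every $T$-invariant set has measure $0$ or $1$. **Homogenization.** Let $A:\mathbb{R}^n\to\mathbb{R}^{n\times n}_{\mathrm{sym}}$ (symmetric real $n\times n$ matrices) be measurable, and suppose there are constants $0<\nu_1<\nu_2$ with $\nu_1|\xi|^2\le\xi\cdot A(x)\xi\le\nu_2|\xi|^2$ for all $\xi\in\mathbb{R}^n$ and almost every $x\in\mathbb{R}^n$. For $\varepsilon>0$ let $A^\varepsilon(x)=A(\varepsilon^{-1}x)$. $A$ admits homogenization if there exists a constant symmetric positive definite matrix $A^0$ (the homogenized matrix, or homogenized coefficient when $n=1$) such that for any bounded domain $D\subset\mathbb{R}^n$ and any $f\in H^{-1}(D)$,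 the weak solutions $u^\varepsilon\in H^1_0(D)$ of $-\mathrm{div}(A^\varepsilon\nabla u^\varepsilon)=f$ in $D$, $u^\varepsilon=0$ on $\partial D$, satisfy, as $\varepsilon\to0$, $u^\varepsilon\rightharpoonup u^0$ weakly in $H^1_0(D)$ and $A^\varepsilon\nabla u^\varepsilon\rightharpoonup A^0\nabla u^0$ weakly in $L^2(D;\mathbb{R}^n)$, where $u^0\in H^1_0(D)$ is the weak solution of $-\mathrm{div}(A^0\nabla u^0)=f$ in $D$, $u^0=0$ on $\partial D$. Here the case $n=1$ is used, with a scalar coefficient, $\nabla=\mathrm{div}=d/dx$, and $D$ a bounded open interval. *)

(* Defs.v *)
From HB Require Import structures.
From mathcomp Require Import all_boot all_order all_algebra.
From mathcomp Require Import all_classical all_reals all_analysis.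
Import Order.TTheory GRing.Theory Num.Theory.
Import numFieldNormedType.Exports.
Set Implicit Arguments.
Unset Strict Implicit.
Unset Printing Implicit Defensive.
Local Open Scope classical_set_scope.
Local Open Scope ring_scope.

Section DynamicalSystem.
Context (R : realType) (d : measure_display) (Omega : measurableType d)
  (P : probability Omega R).

Record measure_preserving_system (T : R -> Omega -> Omega) : Prop := {
  mps_measurable : forall x, measurable_fun [set: Omega] (T x) ;
  mps_add : forall x y, T (x + y) = T x \o T y ;
  mps_id : T 0 = id ;
  mps_preserving : forall x F, measurable F -> P (T x @^-1` F) = P F ;
  mps_joint : forall (d' : measure_display) (X : measurableType d')
      (g : Omega -> X), measurable_fun [set: Omega] g ->
    measurable_fun [set: R * Omega] (fun p : R * Omega => g (T p.1 p.2)) }.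

Definition invariant_set (T : R -> Omega -> Omega) (E : set Omega) : Prop :=
  measurable E /\ forall x, T x @^-1` E = E.

Definition ergodic (T : R -> Omega -> Omega) : Prop :=
  forall E, invariant_set T E -> P E = 0%E \/ P E = 1%E.

End DynamicalSystem.

(* Functions on an open set D of the line are represented by total functions
   R -> R of which only the (almost everywhere) values on D matter. *)
Section Sobolev.
Context (R : realType) (D : set R).
Local Notation mu := (@lebesgue_measure R).
Implicit Types (u v g phi : R -> R).

(* The zero extension of u is square integrable on the line. *)
Definition L2 u : Prop := u \_ D \in Lfun mu 2%:E.

Definition test_function phi : Prop :=
  [/\ forall (k : nat) (x : R), derivable (derive1n k phi) x 1,
      compact (closure [set x | phi x != 0]) &
      closure [set x | phi x != 0] `<=` D].

Definition is_weak_derivative u g : Prop :=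
  [/\ L2 u, L2 g & forall phi, test_function phi ->
    (\int[mu]_(x in D) (u x * derive1 phi x) =
       - \int[mu]_(x in D) (g x * phi x))%R].

Definition H1 u : Prop := exists g, is_weak_derivative u g.

(* A chosen representative, unique almost everywhere on D, of the weak
   derivative of u (arbitrary when u is not in H1). *)
Definition weak_derivative u : R -> R := get [set g | is_weak_derivative u g].

Definition H1norm u : R :=
  Num.sqrt (\int[mu]_(x in D) (u x ^+ 2) +
            \int[mu]_(x in D) (weak_derivative u x ^+ 2))%R.

Definition H10 u : Prop :=
  H1 u /\ exists phi : nat -> R -> R,
    (forall k, test_function (phi k)) /\
    (fun k => H1norm (u \- phi k)) @ \oo --> (0 : R).

(* Boundedness and linearity make F compatible with equality a.e. on D. *)
Definition H_minus1 (F : (R -> R) -> R) : Prop :=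
  (forall (c : R) u v, H10 u -> H10 v ->
     F (fun x => c * u x + v x) = c * F u + F v) /\
  exists C : R, forall u, H10 u -> `|F u| <= C * H1norm u.

Definition weak_solution (A : R -> R) (f : (R -> R) -> R) u : Prop :=
  H10 u /\ forall v, H10 v ->
    (\int[mu]_(x in D) (A x * weak_derivative u x * weak_derivative v x))%R
      = f v.

Definition weak_cvg_H10 (u : R -> R -> R) (u0 : R -> R) : Prop :=
  forall F, H_minus1 F -> F (u eps) @[eps --> 0^'+] --> F u0.

Definition weak_cvg_L2 (w : R -> R -> R) (w0 : R -> R) : Prop :=
  forall g, L2 g ->
    (\int[mu]_(x in D) (w eps x * g x))%R @[eps --> 0^'+] -->
    (\int[mu]_(x in D) (w0 x * g x))%R.

End Sobolev.

Section Homogenization.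
Context (R : realType).
Implicit Type A : R -> R.

Definition elliptic A : Prop :=
  measurable_fun [set: R] A /\
  exists nu1 nu2 : R, [/\ 0 < nu1, nu1 < nu2 &
    {ae @lebesgue_measure R, forall x, forall xi : R,
       nu1 * `|xi| ^+ 2 <= xi * (A x * xi) <= nu2 * `|xi| ^+ 2}].

(* The solutions u eps and u0 exist and are unique up to a.e. equality
   (Lax-Milgram), so they are introduced by universal quantification. *)
Definition homogenized_coefficient A (a0 : R) : Prop :=
  [/\ elliptic A, 0 < a0 &
    forall (alpha beta : R), alpha < beta ->
    let D := `]alpha, beta[%classic in
    forall f : (R -> R) -> R, H_minus1 D f ->
    forall (u : R -> R -> R) (u0 : R -> R),
      (forall eps : R, 0 < eps ->
         weak_solution D (fun x => A (eps^-1 * x)) f (u eps)) ->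
      weak_solution D (cst a0) f u0 ->
      weak_cvg_H10 D u u0 /\
      weak_cvg_L2 D
        (fun eps x => A (eps^-1 * x) * weak_derivative D (u eps) x)
        (fun x => a0 * weak_derivative D u0 x)].

Definition admits_homogenization A : Prop :=
  exists a0, homogenized_coefficient A a0.

End Homogenization.

(* Main.v *)
Require Import Defs.
From HB Require Import structures.
From mathcomp Require Import all_boot all_order all_algebra.
From mathcomp Require Import all_classical all_reals all_analysis.
From mathcomp Require Import measurable_realfun.
From mathcomp Require Import ring lra.
Import Order.TTheory GRing.Theory Num.Theory.
Import numFieldNormedType.Exports.
Set Implicit Arguments.
Unset Strict Implicit.
Unset Printing Implicit Defensive.
Local Open Scope classical_set_scope.
Local Open Scope ring_scope.

(** In dimension one the problem can be integrated by hand.  The rescaled flux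
A(x/eps) u_eps' and the flux a0 u_0' of the limit problem have the same
divergence, so by the du Bois-Reymond lemma ([du_bois_reymond]) they differ by
a constant c_eps on the interval ([flux_constant]).  Dividing by A(x/eps) and
writing b = 1/A, m = 1/a0,

    u_eps' = b(x/eps) (a0 u_0' + c_eps),

and since the derivative of a function of H^1_0 has mean zero, c_eps is
controlled by the integral of (b(x/eps) - m) u_0' ([flux_constant_le]).  All
therefore rests on one property of b: the fluctuation b(x/eps) - m tends to 0
when integrated against any fixed integrable function.  As b is bounded, it is
enough that its integrals over fixed intervals tend to 0
([family_cvg_integrable]), and by rescaling this says that the averages of b
over ]0, r[ and over ]-r, 0[ tend to m ([mean_dilation_itv]).  Then c_eps tends
to 0, the fluxes converge, and u_eps' - u_0' tends to 0 weakly in L^2.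

Weak convergence in H^1_0 asks for all bounded functionals F.  The Riesz
theorem would write F as the pairing with a fixed derivative; an approximate
minimiser of the Dirichlet energy provides such a pairing up to an error that
is small relative to the energy ([approx_riesz]), and the energy of
u_eps - u_0 stays bounded ([energy_remainder_bounded]).  This gives the
deterministic statement [homogenization_of_mean]: if b has mean m in both
directions, A homogenizes with coefficient 1/m.

That b(x) = 1/a(T_x omega) has mean E(1/a) for almost every omega is Birkhoff's
theorem for the flow ([birkhoff_cvg]).  The proof goes through the maximal
ergodic inequality for the time-one map ([maximal_ergodic]), which need not be
ergodic itself.  The set where the averages exceed a level c infinitely often,
by a margin, is however invariant under the whole flow ([exceed_invariant]),
hence null or of full measure, and the maximal inequality excludes full measure
when c is above the mean ([exceed_null]).  Lower bounds follow by complementing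
the function in a constant, the averages over ]-r, 0[ by reversing time.
Finally the bounds on a hold only almost everywhere; Tonelli's theorem turns
them into bounds at almost every point of almost every orbit ([ae_orbit]).

The trial functions of H^1_0 are limits of smooth compactly supported
functions, so a supply of these is needed: they are built from the function
exp(-1/x) ([smooth_flat], [smooth_step]). *)

(** * Almost everywhere statements and integrals of real functions *)

Section AlmostEverywhere.
Context d (T : measurableType d) (R : realType) (m : {measure set T -> \bar R}).

Lemma aeS (P Q : T -> Prop) : (forall x, P x -> Q x) ->
  {ae m, forall x, P x} -> {ae m, forall x, Q x}.
Proof. by move=> PQ; exact: (@filterS _ _ (ae_filter_ringOfSetsType m)). Qed.

Lemma aeS2 (P Q S : T -> Prop) : (forall x, P x -> Q x -> S x) ->
  {ae m, forall x, P x} -> {ae m, forall x, Q x} -> {ae m, forall x, S x}.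
Proof. by move=> PQ; exact: (@filterS2 _ _ (ae_filter_ringOfSetsType m)). Qed.

Lemma aeS3 (P Q S U : T -> Prop) : (forall x, P x -> Q x -> S x -> U x) ->
  {ae m, forall x, P x} -> {ae m, forall x, Q x} -> {ae m, forall x, S x} ->
  {ae m, forall x, U x}.
Proof. by move=> PQ; exact: (@filterS3 _ _ (ae_filter_ringOfSetsType m)). Qed.

End AlmostEverywhere.

Section RealIntegrals.
Context d (T : measurableType d) (R : realType) (m : {measure set T -> \bar R}).
Variables (D : set T).
Hypothesis mD : measurable D.
Implicit Types (f g h : T -> R).

Lemma integrable_measurable f : m.-integrable D (EFin \o f) -> measurable_fun D f.
Proof. by move=> /measurable_int/measurable_EFinP. Qed.

Lemma ae_le_integrable f g : measurable_fun D f -> m.-integrable D (EFin \o g) ->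
  {ae m, forall x, D x -> `|f x| <= g x} -> m.-integrable D (EFin \o f).
Proof.
move=> mf ig fg; have /integrableP[mg goo] := ig.
apply/integrableP; split; first exact/measurable_EFinP.
apply: le_lt_trans goo; apply: ae_ge0_le_integral => //.
- by apply: measurableT_comp => //; exact/measurable_EFinP.
- by apply: measurableT_comp => //; exact/measurable_EFinP.
- apply: filterS fg => x fg Dx; rewrite lee_fin.
  by rewrite (le_trans (fg Dx))// ler_norm.
Qed.

Lemma ae_eq_integrableR f g : measurable_fun D g -> m.-integrable D (EFin \o f) ->
  {ae m, forall x, D x -> f x = g x} -> m.-integrable D (EFin \o g).
Proof.
move=> mg fi fg; apply: (@ae_le_integrable _ (fun x => `|f x|)) => //.
  exact: integrable_norm.
by apply: filterS fg => x fg Dx; rewrite -fg.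
Qed.

Lemma ae_eq_Rintegral f g : measurable_fun D f -> measurable_fun D g ->
  {ae m, forall x, D x -> f x = g x} ->
  \int[m]_(x in D) f x = \int[m]_(x in D) g x.
Proof.
move=> mf mg fg; congr fine; apply: ae_eq_integral => //.
- exact/measurable_EFinP.
- exact/measurable_EFinP.
- by apply: filterS fg => x fg Dx; rewrite fg.
Qed.

Lemma ae_le_Rintegral f g : m.-integrable D (EFin \o f) -> m.-integrable D (EFin \o g) ->
  {ae m, forall x, D x -> f x <= g x} ->
  \int[m]_(x in D) f x <= \int[m]_(x in D) g x.
Proof.
move=> fi gi fg.
(* The maximum is above f everywhere and agrees with g almost everywhere. *)
pose h x := Num.max (f x) (g x).
have mf := integrable_measurable fi; have mg := integrable_measurable gi.
have mh : measurable_fun D h by exact: measurable_maxr.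
have gh : {ae m, forall x, D x -> g x = h x}.
  by apply: filterS fg => x fg Dx; rewrite /h max_r// fg.
rewrite (ae_eq_Rintegral mg mh gh); apply: le_Rintegral => //.
  exact: ae_eq_integrableR gh.
by move=> x Dx; rewrite /h le_max lexx.
Qed.

Lemma integrable_scale (c : R) f : m.-integrable D (EFin \o f) ->
  m.-integrable D (EFin \o (fun x => c * f x)).
Proof. by move=> fi; have := integrableZl mD c fi; apply: eq_integrable. Qed.

Lemma integrableZD (c : R) f g : m.-integrable D (EFin \o f) ->
  m.-integrable D (EFin \o g) ->
  m.-integrable D (EFin \o (fun x => c * f x + g x)).
Proof.
move=> fi gi.
have := integrableD mD (integrableZl mD c fi) gi.
by apply: eq_integrable.
Qed.

Lemma RintegralZD (c : R) f g : m.-integrable D (EFin \o f) ->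
  m.-integrable D (EFin \o g) ->
  \int[m]_(x in D) (c * f x + g x) =
  c * \int[m]_(x in D) f x + \int[m]_(x in D) g x.
Proof.
move=> fi gi; rewrite RintegralD//; last exact: integrable_scale.
by rewrite RintegralZl.
Qed.

Lemma integrable_bddM (M : R) f h : measurable_fun D h ->
  {ae m, forall x, D x -> `|h x| <= M} ->
  m.-integrable D (EFin \o f) -> m.-integrable D (EFin \o (fun x => h x * f x)).
Proof.
move=> mh hM fi; apply: (@ae_le_integrable _ (fun x => M * `|f x|)).
- by apply: measurable_funM => //; exact: integrable_measurable.
- exact: (integrable_scale M (integrable_norm fi)).
- by apply: filterS hM => x hM Dx; rewrite normrM ler_wpM2r// hM.
Qed.

Lemma Rintegral_bddM_le (M : R) f h : measurable_fun D h ->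
  {ae m, forall x, D x -> `|h x| <= M} ->
  m.-integrable D (EFin \o f) ->
  `|\int[m]_(x in D) (h x * f x)| <= M * \int[m]_(x in D) `|f x|.
Proof.
move=> mh hM fi.
have nf := integrable_norm fi; have hf := integrable_bddM mh hM fi.
apply: (le_trans (le_normr_Rintegral mD hf)).
rewrite -RintegralZl//.
apply: ae_le_Rintegral.
- exact: integrable_norm.
- exact: integrable_scale.
- by apply: filterS hM => x hM Dx; rewrite normrM ler_wpM2r// hM.
Qed.

Lemma ge0_subset_Rintegral (A : set T) f : measurable A -> A `<=` D ->
  (forall x, 0 <= f x) -> m.-integrable D (EFin \o f) ->
  \int[m]_(x in A) f x <= \int[m]_(x in D) f x.
Proof.
move=> mA AD f0 fi; have fiA := integrableS mD mA AD fi.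
apply: fine_le; [exact: integrable_fin_num|exact: integrable_fin_num|].
apply: ge0_subset_integral => //; first by have /integrableP[] := fi.
by move=> x _; rewrite lee_fin.
Qed.

End RealIntegrals.

(** * A smooth bump *)

Section Smooth.
Context {R : realType}.
Implicit Types (f g : R -> R) (x t : R).

(** Differentiation is peeled off from the inside, so that closure properties go
by induction on k: the derivative of a product or of a composite is made of
functions to which the induction hypothesis applies. *)
Fixpoint Ck (k : nat) f : Prop :=
  (forall x, derivable f x 1) /\ (if k is k'.+1 then Ck k' (derive1 f) else True).

Definition smooth f : Prop := forall k x, derivable (derive1n k f) x 1.

Lemma CkW k f : Ck k.+1 f -> Ck k f.
Proof.
elim: k f => [|k IH] f [df Cf]; split=> //.
exact: IH.
Qed.

Lemma Ck_smooth f : (forall k, Ck k f) -> smooth f.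
Proof.
move=> + k => /(_ k); elim: k f => [|k IH] f.
  by move=> [].
by move=> [_ /IH]; rewrite derive1Sn.
Qed.

Lemma smooth_Ck f k : smooth f -> Ck k f.
Proof.
elim: k f => [|k IH] f sf; split => //; first exact: (sf 0%N).
  exact: (sf 0%N).
by apply: IH => j x; rewrite -derive1Sn; exact: sf.
Qed.

Lemma smooth_derivable f : smooth f -> forall x, derivable f x 1.
Proof. by move=> /(_ 0%N). Qed.

Lemma smooth_derive1 f : smooth f -> smooth (derive1 f).
Proof. by move=> sf k x; rewrite -derive1Sn; exact: sf. Qed.

Lemma smooth_primitive f : (forall x, derivable f x 1) -> smooth (derive1 f) -> smooth f.
Proof.
by move=> df sf [|k] x; [exact: df|rewrite derive1Sn; exact: sf].
Qed.

Lemma is_derive1 f x (d : R) : is_derive x 1 f d -> derive1 f x = d.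
Proof. by move=> fd; rewrite derive1E derive_val. Qed.

Lemma derivable1_is_derive f x : derivable f x 1 -> is_derive x 1 f (derive1 f x).
Proof. by move=> df; rewrite derive1E; exact/derivableP. Qed.

Lemma CkZD k (c : R) f g : Ck k f -> Ck k g -> Ck k (fun x => c * f x + g x).
Proof.
elim: k f g => [|k IH] f g [df Cf] [dg Cg].
  by split=> [x|//]; apply: (@derivableD _ _ _ (c \*: f)); [exact/derivableZ/df|exact: dg].
have fg x : is_derive x 1 (fun x => c * f x + g x) (c * derive1 f x + derive1 g x).
  by apply: (@is_deriveD _ _ _ (c \*: f)); [apply: is_deriveZ|];
    exact: derivable1_is_derive.
split=> [x|]; first by have [] := fg x.
suff -> : derive1 (fun x => c * f x + g x) = (fun x => c * derive1 f x + derive1 g x).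
  exact: IH.
by apply/funext => x; exact: is_derive1.
Qed.

Lemma CkM k f g : Ck k f -> Ck k g -> Ck k (fun x => f x * g x).
Proof.
elim: k f g => [|k IH] f g Hf Hg.
  move: Hf Hg => [df Cf] [dg Cg].
  by split=> [x|//]; apply: (@derivableM _ _ f); [exact: df|exact: dg].
move: (Hf) (Hg) => [df Cf] [dg Cg].
have fg x : is_derive x 1 (fun x => f x * g x) (f x * derive1 g x + g x * derive1 f x).
  by apply: (@is_deriveM _ _ f); exact: derivable1_is_derive.
split=> [x|]; first by have [] := fg x.
suff -> : derive1 (fun x => f x * g x) =
    (fun x => 1 * (f x * derive1 g x) + g x * derive1 f x).
  by apply: CkZD; apply: IH => //; exact: CkW.
by apply/funext => x; rewrite mul1r; exact: is_derive1.
Qed.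

Lemma is_derive_affine f (a b x d : R) : is_derive (a * x + b) 1 f d ->
  is_derive x 1 (fun y => f (a * y + b)) (a * d).
Proof.
move=> fd; rewrite mulrC.
apply: (@is_derive1_comp _ f (fun y => a * y + b)).
have H := is_deriveD (is_deriveZ a (is_derive_id x 1)) (is_derive_cst b x 1).
by apply: (is_derive_eq H); rewrite addr0 [_ *: _]mulr1.
Qed.

Lemma Ck_affine k (a b : R) f : Ck k f -> Ck k (fun x => f (a * x + b)).
Proof.
elim: k f => [|k IH] f [df Cf].
  split=> [x|//].
  by have [] := is_derive_affine (derivable1_is_derive (df (a * x + b))).
have fg x : is_derive x 1 (fun x => f (a * x + b)) (a * derive1 f (a * x + b)).
  exact/is_derive_affine/derivable1_is_derive.
split=> [x|]; first by have [] := fg x.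
suff -> : derive1 (fun x => f (a * x + b)) =
    (fun x => a * derive1 f (a * x + b) + (fun=> 0) x).
  apply: CkZD; first exact: IH.
  elim: {IH Cf fg} k => [|k IH]; (split; [by move=> x; exact: derivable_cst|]); first by [].
  suff -> : derive1 (fun=> 0) = (fun=> 0) :> (R -> R) by [].
  by apply/funext => x; rewrite derive1_cst.
by apply/funext => x; rewrite addr0; exact: is_derive1.
Qed.

Lemma smoothZD (c : R) f g : smooth f -> smooth g ->
  smooth (fun x => c * f x + g x).
Proof. by move=> sf sg; apply: Ck_smooth => k; apply: CkZD; exact: smooth_Ck. Qed.

Lemma smoothM f g : smooth f -> smooth g -> smooth (fun x => f x * g x).
Proof. by move=> sf sg; apply: Ck_smooth => k; apply: CkM; exact: smooth_Ck. Qed.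

Lemma smooth_affine (a b : R) f : smooth f -> smooth (fun x => f (a * x + b)).
Proof. by move=> sf; apply: Ck_smooth => k; apply: Ck_affine; exact: smooth_Ck. Qed.

(** The functions x^-n exp(-1/x), cut off at 0: their derivatives are
combinations of functions of the same family. *)
Definition flat (n : nat) x : R :=
  if 0 < x then x^-1 ^+ n * expR (- x^-1) else 0.

Lemma flat_ge0 n x : 0 <= flat n x.
Proof.
rewrite /flat; case: ifPn => // x0.
by rewrite mulr_ge0 ?expR_ge0// exprn_ge0// invr_ge0 ltW.
Qed.

(** One term of the exponential series at 1/x, of degree n+1, beats the pole x^-n
with a factor x to spare. *)
Lemma flat_le n x : flat n x <= (n.+1)`!%:R * `|x|.
Proof.
rewrite /flat; case: ifPn => [x0|_]; last by rewrite mulr_ge0.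
rewrite gtr0_norm// expRN ler_pdivrMr ?expR_gt0//.
have y0 : 0 < x^-1 by rewrite invr_gt0.
have := @expR_ge1Dxn R x^-1 n (ltW y0).
set E := expR _; set y := x^-1 => Ey.
have -> : y ^+ n = (n.+1)`!%:R * x * (y ^+ n.+1 / (n.+1)`!%:R).
  have F0 : (n.+1)`!%:R != 0 :> R by rewrite pnatr_eq0 -lt0n fact_gt0.
  have yx : x * y = 1 by rewrite mulfV// gt_eqF.
  move: F0; set F := _%:R => F0.
  transitivity ((x * y) * y ^+ n * (F / F)); first by rewrite yx divff// mul1r mulr1.
  by rewrite exprS; ring.
apply: ler_wpM2l; first by rewrite mulr_ge0// ltW.
by apply: le_trans Ey; rewrite lerDr.
Qed.

(** At the origin the difference quotient of [flat n] is [flat n.+1], which tends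
to 0 by [flat_le]. *)
Lemma is_derive_flat n x :
  is_derive x 1 (flat n) (flat n.+2 x - n%:R * flat n.+1 x).
Proof.
have [x0|x0|<-] := ltgtP 0 x.
- apply: (@near_eq_is_derive _ _ _ (fun x => x^-1 ^+ n * expR (- x^-1))).
    near=> y; rewrite /flat ifT//.
    near: y; exact: lt_nbhsr.
  have dV : is_derive x 1 (fun x : R => x^-1) (- x ^- 2).
    have := @is_deriveV _ id x 1 1 (lt0r_neq0 x0).
    by rewrite [_ *: _]mulr1; apply.
  have dE : is_derive x 1 (fun x : R => expR (- x^-1)) (expR (- x^-1) * x ^- 2).
    apply: (@is_derive1_comp _ expR (fun x => - x^-1)).
    rewrite -[x ^- 2]opprK.
    by apply: is_deriveN.
  have dP : is_derive x 1 (fun x : R => x^-1 ^+ n)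
     ((n%:R * x^-1 ^+ n.-1) *: - x ^- 2).
    by rewrite -(exprfctE (fun x : R => x^-1)); apply: is_deriveX.
  apply: (is_derive_eq (is_deriveM dP dE)).
  rewrite /flat x0 /GRing.scale/=.
  case: n {dP} => [|n] /=; rewrite ?expr0 ?mul0r ?mul1r !exprS ?expr0;
    by field; rewrite gt_eqF.
- apply: (@near_eq_is_derive _ _ _ (fun x => 0)).
    near=> y; rewrite /flat ifF//; apply/negbTE; rewrite -leNgt ltW//.
    near: y; exact: lt_nbhsl.
  by rewrite /flat ltNge (ltW x0)/= mulr0 subrr; exact: is_derive_cst.
- rewrite /flat ltxx mulr0 subrr.
  have H : h^-1 *: (flat n (h *: 1 + 0) - flat n 0) @[h --> 0^'] --> 0.
    apply/cvgrPdist_le => e e0.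
    near=> h.
    rewrite sub0r normrN addr0 [h *: 1]mulr1 /flat ltxx subr0.
    have -> : h^-1 *: flat n h = flat n.+1 h.
      by rewrite /flat /GRing.scale/=; case: ifPn => _; rewrite ?mulr0// exprS mulrA.
    rewrite ger0_norm ?flat_ge0//; apply: (le_trans (flat_le _ _)).
    rewrite -ler_pdivlMl ?ltr0n ?fact_gt0//.
    near: h; apply: dnbhs0_le.
    by rewrite mulr_gt0// invr_gt0 ltr0n fact_gt0.
  apply: DeriveDef; last exact/cvg_lim.
  by apply/cvg_ex; exists 0.
Unshelve. all: by end_near. Qed.

Lemma smooth_flat n : smooth (flat n).
Proof.
apply: Ck_smooth => k; elim: k n => [|k IH] n.
  by split=> // x; have [] := is_derive_flat n x.
split=> [x|]; first by have [] := is_derive_flat n x.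
suff -> : derive1 (flat n) = (fun x => (- n%:R) * flat n.+1 x + flat n.+2 x).
  exact: CkZD.
by apply/funext => x; rewrite mulNr addrC; exact/is_derive1/is_derive_flat.
Qed.

Definition bump x : R := flat 0 x * flat 0 (1 - x).

Lemma smooth_bump : smooth bump.
Proof.
apply: smoothM; first exact: smooth_flat.
rewrite (_ : (fun x => flat 0 (1 - x)) = (fun x => flat 0 ((-1) * x + 1))).
  exact/smooth_affine/smooth_flat.
by apply/funext => x; rewrite mulN1r addrC.
Qed.

Lemma bump_ge0 x : 0 <= bump x.
Proof. by rewrite mulr_ge0// flat_ge0. Qed.

Lemma bump_le1 x : bump x <= 1.
Proof.
suff H y : flat 0 y <= 1 by rewrite mulr_ile1// flat_ge0.
rewrite /flat; case: ifPn => // y0; rewrite mul1r expR_le1 oppr_le0 invr_ge0.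
exact: ltW.
Qed.

Lemma bump_eq0 x : x <= 0 \/ 1 <= x -> bump x = 0.
Proof.
rewrite /bump /flat => -[x0|x1]; first by rewrite ltNge x0/= mul0r.
by rewrite subr_gt0 [1 > _]ltNge x1/= mulr0.
Qed.

Lemma bump_gt0 x : 0 < x -> x < 1 -> 0 < bump x.
Proof.
by move=> x0 x1; rewrite /bump /flat x0 subr_gt0 x1 !mul1r mulr_gt0// expR_gt0.
Qed.

Lemma smooth_continuous f : smooth f -> continuous f.
Proof.
by move=> sf x; apply/differentiable_continuous/derivable1_diffP/smooth_derivable.
Qed.

End Smooth.

(** * Smooth steps and test functions *)

Section Integration.
Context {R : realType}.
Local Notation mu := (@lebesgue_measure R).
Implicit Types (f g : R -> R) (a b x y t : R).

Lemma continuous_integrable_itv f a b (i : interval R) : continuous f ->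
  [set` i] `<=` `[a, b] -> mu.-integrable [set` i] (EFin \o f).
Proof.
move=> cf iab; apply: (@integrableS _ _ _ mu `[a, b]) => //.
apply: continuous_compact_integrable; first exact: segment_compact.
exact: continuous_subspaceT.
Qed.

Lemma continuous_integrable_oo f a b : continuous f ->
  mu.-integrable `]a, b[ (EFin \o f).
Proof.
by move=> cf; apply: (@continuous_integrable_itv _ a b) => //; exact: subset_itv_oo_cc.
Qed.

Lemma integral_derive1 f a b : a < b -> (forall x, derivable f x 1) ->
  continuous (derive1 f) ->
  \int[mu]_(x in `]a, b[) derive1 f x = f b - f a.
Proof.
move=> ab df cf'.
rewrite Rintegral_itv_bndo_bndc; last exact: continuous_integrable_oo.
rewrite Rintegral_itv_obnd_cbnd; last first.
  by apply: (@continuous_integrable_itv _ a b) => //; exact: subset_itv_oc_cc.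
have cf : continuous f.
  by move=> x; apply/differentiable_continuous/derivable1_diffP.
have dF : derivable_oo_LRcontinuous f a b.
  split; [by move=> x _; exact: df| |].
  - exact/cvg_at_right_filter/cf.
  - exact/cvg_at_left_filter/cf.
by rewrite /Rintegral (continuous_FTC2 ab (continuous_subspaceT cf') dF (fun _ _ => erefl)).
Qed.

End Integration.

Section Step.
Context {R : realType}.
Local Notation mu := (@lebesgue_measure R).
Implicit Types (f g : R -> R) (a b x y t : R).

Definition step x : R := \int[mu]_(t in `]-oo, x]) bump t.

Lemma continuous_bump : continuous (@bump R).
Proof. exact/smooth_continuous/smooth_bump. Qed.

Lemma bump_integrable (D : set R) : measurable D -> mu.-integrable D (EFin \o bump).
Proof.
move=> mD; apply: (@integrableS _ _ _ mu setT) => //.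
have : mu.-integrable `[0, 1] (EFin \o bump).
  by apply: (@continuous_integrable_itv _ _ 0 1) => //; exact: continuous_bump.
move=> H0.
have H : mu.-integrable setT ((EFin \o bump) \_ `[0, 1]).
  by have /integrable_mkcond := H0; apply.
apply: eq_integrable H => // x _.
rewrite patchE; case: ifPn => // /negP xN.
rewrite /= bump_eq0//; have [x0|x0] := leP x 0; [by left|right].
rewrite leNgt; apply/negP => x1; apply: xN; rewrite inE/= in_itv/=.
by rewrite !ltW.
Qed.

Lemma is_derive_step x : is_derive x 1 step (bump x).
Proof.
have xx1 : x < x + 1 by rewrite ltrDl.
have ooi := @bump_integrable `]-oo, x + 1] (measurable_itv _).
have oox : (-oo%O < BRight x)%E by exact: ltNyr.
have [df <-] := continuous_FTC1 xx1 ooi oox (@continuous_bump x).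
exact: derivable1_is_derive.
Qed.

Lemma derive1_step : derive1 step = bump.
Proof. by apply/funext => x; exact/is_derive1/is_derive_step. Qed.

Lemma smooth_step : smooth step.
Proof.
apply: smooth_primitive; last by rewrite derive1_step; exact: smooth_bump.
by move=> x; have [] := is_derive_step x.
Qed.

Lemma step_eq0 x : x <= 0 -> step x = 0.
Proof.
move=> x0; rewrite /step (_ : 0 = \int[mu]_(t in `]-oo, x]) 0).
  apply: eq_Rintegral => t; rewrite inE/= in_itv/= => tx.
  by rewrite bump_eq0//; left; exact: le_trans x0.
by rewrite Rintegral_cst// mul0r.
Qed.

Lemma step_eq1 x : 1 <= x -> step x = step 1.
Proof.
rewrite le_eqVlt => /predU1P[->//|x1].
apply/eqP; rewrite -subr_eq0; apply/eqP.
rewrite -integral_derive1// ?derive1_step; last 2 first.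
- by move=> y; have [] := is_derive_step y.
- exact: continuous_bump.
rewrite (_ : 0 = \int[mu]_(t in `]1, x[) 0).
  apply: eq_Rintegral => t; rewrite inE/= in_itv/= => /andP[tx _].
  by rewrite bump_eq0//; right; exact: ltW.
by rewrite Rintegral_cst// mul0r.
Qed.

(** Otherwise [step], which is monotone, would be identically 0, and so would its
derivative [bump]. *)
Lemma step1_gt0 : 0 < step 1.
Proof.
have S0 x : 0 <= step x by apply: Rintegral_ge0 => t _; exact: bump_ge0.
have S1 x : step x <= step 1.
  have [x1|x1] := leP 1 x; first by rewrite step_eq1.
  rewrite -subr_ge0 -integral_derive1//.
  - by rewrite derive1_step; apply: Rintegral_ge0 => t _; exact: bump_ge0.
  - by move=> y; have [] := is_derive_step y.
  - by rewrite derive1_step; exact: continuous_bump.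
rewrite lt_neqAle S0 andbT; apply/negP => /eqP S10.
have : derive1 step 2^-1 = 0.
  rewrite (_ : step = cst 0) ?derive1_cst//.
  by apply/funext => x; apply/le_anti; rewrite S0 andbT [leRHS]S10.
rewrite derive1_step => /eqP; apply/negP; rewrite gt_eqF// bump_gt0//.
by rewrite invf_lt1// ltr1n.
Qed.

(** The rise from 0 to [step 1] takes place on [x, x + 1/k]. *)
Definition scaled_step (k x t : R) : R := step (k * t + - (k * x)).

Lemma smooth_scaled_step k x : smooth (scaled_step k x).
Proof. exact/smooth_affine/smooth_step. Qed.

Lemma derive1_scaled_step k x : derive1 (scaled_step k x) = fun t => k * bump (k * t + - (k * x)).
Proof. by apply/funext => t; exact/is_derive1/is_derive_affine/is_derive_step. Qed.

Lemma scaled_step_eq0 k x t : 0 < k -> t <= x -> scaled_step k x t = 0.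
Proof. by move=> k0 tx; rewrite /scaled_step step_eq0// subr_le0 ler_pM2l. Qed.

Lemma scaled_step_eq1 k x t : 0 < k -> x + k^-1 <= t -> scaled_step k x t = step 1.
Proof.
move=> k0 tx; rewrite /scaled_step step_eq1// -mulrBr -ler_pdivrMl// mulr1.
by rewrite lerBrDl.
Qed.

End Step.

Section TestFunction.
Context {R : realType}.
Local Notation mu := (@lebesgue_measure R).
Implicit Types (f g phi psi : R -> R) (a b x y t : R).

Lemma test_smooth (D : set R) phi : test_function D phi -> smooth phi.
Proof. by case. Qed.

Lemma test_eq0 (D : set R) phi x : test_function D phi -> ~ D x -> phi x = 0.
Proof.
move=> [_ _ sD] Dx; apply/eqP/negPn/negP => phix; apply: Dx; apply: sD.
exact: subset_closure.
Qed.

(** Any compact K outside which phi vanishes will do, which spares computing the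
closure of the set where phi is nonzero. *)
Lemma test_function_of_support (D K : set R) phi : smooth phi -> compact K -> K `<=` D ->
  (forall t, ~ K t -> phi t = 0) -> test_function D phi.
Proof.
move=> sphi cK KD phi0.
have supp : closure [set t | phi t != 0] `<=` K.
  rewrite [X in _ `<=` X](closure_id K).1; last exact: compact_closed.
  apply: closure_subset => t /= /eqP phit; apply: contrapT => /phi0.
  exact: phit.
split => //; last exact: subset_trans supp _.
by apply: subclosed_compact supp => //; exact: closed_closure.
Qed.

Lemma eq0_off_support phi t : ~ closure [set t | phi t != 0] t -> phi t = 0.
Proof.
move=> ct; apply/eqP/negPn/negP => phit; apply: ct.
exact: subset_closure.
Qed.

Lemma test_functionZD (D : set R) (c : R) phi psi : test_function D phi -> test_function D psi ->
  test_function D (fun x => c * phi x + psi x).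
Proof.
move=> t1 t2; have [s1 c1 d1] := t1; have [s2 c2 d2] := t2.
apply: (@test_function_of_support _ (closure [set t | phi t != 0] `|` closure [set t | psi t != 0])).
- exact: smoothZD.
- exact: compactU.
- by rewrite subUset.
- by move=> t /not_orP[/eq0_off_support -> /eq0_off_support ->]; rewrite mulr0 addr0.
Qed.

Lemma test_function0 (D : set R) : test_function D (fun=> 0).
Proof.
apply: (@test_function_of_support _ set0) => //; last exact: compact0.
move=> k x; rewrite (_ : derive1n k _ = cst 0); first exact: derivable_cst.
elim: k => // k IH; rewrite derive1nS IH; apply/funext => y.
by rewrite derive1_cst.
Qed.

Lemma test_function_derive1 (D : set R) phi : test_function D phi -> test_function D (derive1 phi).
Proof.
move=> tphi; have [s1 c1 d1] := tphi.
apply: (@test_function_of_support _ (closure [set t | phi t != 0])) => //.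
  exact: smooth_derive1.
move=> t ct; rewrite derive1E.
have -> : 'D_1 phi t = 'D_1 (cst 0) t; last by rewrite derive_cst.
apply: near_eq_derive.
have oC : open (~` closure [set t | phi t != 0]) by apply: closed_openC; exact: closed_closure.
near=> y; apply: eq0_off_support.
by near: y; exact: open_nbhs_nbhs.
Unshelve. all: by end_near. Qed.

End TestFunction.

(** * The du Bois-Reymond lemma *)

Section DuBoisReymond.
Context {R : realType}.
Local Notation mu := (@lebesgue_measure R).
Implicit Types (f g h phi psi : R -> R) (a b x y t : R).

Lemma continuous_measurable D f : measurable D -> continuous f -> measurable_fun D f.
Proof.
by move=> mD cf; apply: measurable_funTS; exact: continuous_measurable_fun.
Qed.

(** The derivative of the scaled step is an approximate identity of mass [step 1]:
it is bounded by 1/r and lives on the ball of radius r, so its pairing with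
h - h x is at most twice the mean oscillation of h at the Lebesgue point x. *)
Lemma lebesgue_pt_scaled_step h a b x : a < x -> x < b ->
  mu.-integrable `]a, b[ (EFin \o h) -> lebesgue_pt (h \_ `]a, b[) x ->
  forall e, 0 < e -> \forall r \near 0^'+,
    `|\int[mu]_(t in `]a, b[) (derive1 (scaled_step r^-1 x) t * h t) - step 1 * h x| <= e.
Proof.
move=> ax xb hi hx e e0.
have mh := integrable_measurable hi.
set H := h \_ _ in hx.
have Hh t : t \in `]a, b[ -> H t = h t by move=> tD; rewrite /H patchE mem_set.
have hxx : H x = h x by rewrite Hh// in_itv/= ax xb.
have := hx; rewrite /lebesgue_pt => /fine_fcvg/cvgrPdist_lt/(_ (e / 2)).
rewrite divr_gt0// => /(_ erefl) hx'.
near=> r.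
have r0 : 0 < r by [].
have k0 : 0 < r^-1 by rewrite invr_gt0.
set psi := scaled_step _ _.
have spsi : smooth psi := @smooth_scaled_step _ _ _.
have cpsi' : continuous (derive1 psi) by exact/smooth_continuous/smooth_derive1.
have psi'0 t : 0 <= derive1 psi t.
  by rewrite derive1_scaled_step mulr_ge0// ?bump_ge0// ltW.
have psi'1 t : derive1 psi t <= r^-1.
  by rewrite derive1_scaled_step -[leRHS]mulr1 ler_wpM2l ?bump_le1// ltW.
have xr : x + r <= b.
  by rewrite -lerBrDl; near: r; apply: nbhs_right_le; rewrite subr_gt0.
have xr' : a <= x - r.
  by rewrite lerBrDr -lerBrDl; near: r; apply: nbhs_right_le; rewrite subr_gt0.
have BD : ball x r `<=` `]a, b[.
  rewrite ball_itv => t /=; rewrite !in_itv/= => /andP[t1 t2].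
  by rewrite (le_lt_trans _ t1)// (lt_le_trans t2).
have psi'B t : ~ ball x r t -> derive1 psi t = 0.
  move=> tB; rewrite derive1_scaled_step bump_eq0 ?mulr0//.
  rewrite -mulrBr; have [tx|tx] := leP t x; [left|right].
    by rewrite pmulr_rle0// subr_le0.
  rewrite -ler_pdivrMl// invrK mulr1 leNgt; apply/negP => txr; apply: tB.
  by rewrite /ball/= ltr_distlC; apply/andP; split; lra.
have ipsi : \int[mu]_(t in `]a, b[) derive1 psi t = step 1.
  rewrite (integral_derive1 (lt_trans ax xb) (smooth_derivable spsi) cpsi').
  rewrite /psi scaled_step_eq1 ?invrK// scaled_step_eq0 ?subr0//; exact: ltW.
have psiM : {ae mu, forall t, `]a, b[%classic t -> `|derive1 psi t| <= r^-1}.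
  by apply: aeW => t _; rewrite ger0_norm.
have mpsi : measurable_fun `]a, b[ (derive1 psi) by exact: continuous_measurable.
have hi' : mu.-integrable `]a, b[ (EFin \o (fun t => -1 * h x + h t)).
  apply: (@integrableZD _ _ _ mu _ _ (-1) (cst (h x)) h) => //.
  by apply: continuous_integrable_oo; exact: cst_continuous.
have -> : \int[mu]_(t in `]a, b[) (derive1 psi t * h t) - step 1 * h x =
    \int[mu]_(t in `]a, b[) (derive1 psi t * (-1 * h x + h t)).
  rewrite -ipsi -RintegralZr//; last exact: continuous_integrable_oo.
  rewrite -RintegralB//; last 2 first.
  - exact: integrable_bddM psiM hi.
  - have : mu.-integrable `]a, b[ (EFin \o (cst (h x))).
      by apply: continuous_integrable_oo; exact: cst_continuous.
    by move=> ci; exact: integrable_bddM psiM ci.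
  by apply: eq_Rintegral => t _; ring.
have hB : mu.-integrable (ball x r) (EFin \o (fun t => -1 * h x + h t)).
  by apply: integrableS hi' => //; exact: measurable_ball.
rewrite (_ : \int[mu]_(t in _) _ =
    \int[mu]_(t in ball x r) (derive1 psi t * (-1 * h x + h t))); last first.
  rewrite -[in RHS](setIidr BD) Rintegral_mkcondr.
  apply: eq_Rintegral => t tD; rewrite patchE; case: ifPn => // /negP tB.
  by rewrite psi'B ?mul0r// => tB'; apply: tB; rewrite inE.
apply: le_trans.
  apply: (@Rintegral_bddM_le _ _ _ _ _ _ r^-1) hB => //.
  - exact: measurable_ball.
  - exact: measurable_funS mpsi.
  - by apply: aeW => t _; rewrite ger0_norm.
have : `|0 - fine (davg H x r)| < e / 2 by near: r.
rewrite sub0r normrN /davg /iavg lebesgue_measure_ball; last exact: ltW.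
rewrite inver mulrn_eq0/= gt_eqF//.
have -> : (\int[mu]_(y in ball x r) `|((center (H x) \o H) y)%:E|)%E =
   (\int[mu]_(y in ball x r) `| -1 * h x + h y|)%:E.
  rewrite /Rintegral fineK; last first.
    by apply: integrable_fin_num; [exact: measurable_ball|exact: integrable_norm].
  apply: eq_integral => t; rewrite inE => tB; rewrite /= hxx Hh//.
    by rewrite mulN1r addrC.
  exact: BD.
rewrite -EFinM/= ger0_norm; last first.
  apply: mulr_ge0; first by rewrite invr_ge0 mulrn_wge0// ltW.
  exact: Rintegral_ge0.
rewrite -[r *+ 2]mulr_natl invfM -mulrA ltr_pdivrMl// => /ltW.
by rewrite (mulrC 2) divfK.
Unshelve. all: by end_near. Qed.

(** The difference of the scaled steps at x and at y is a test function, so the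
two approximate identities assign the same value to h.  In the limit this
compares h x and h y at Lebesgue points. *)
Lemma du_bois_reymond h a b : mu.-integrable `]a, b[ (EFin \o h) ->
  (forall phi, test_function `]a, b[ phi ->
     \int[mu]_(t in `]a, b[) (derive1 phi t * h t) = 0) ->
  exists c, {ae mu, forall x, `]a, b[%classic x -> h x = c}.
Proof.
move=> hi h0.
have mh := integrable_measurable hi.
have ae_pt : {ae mu, forall x, lebesgue_pt (h \_ `]a, b[) x}.
  by apply: lebesgue_differentiation; exact: integrable_locally.
suff H x y : `]a, b[%classic x -> `]a, b[%classic y -> x < y -> lebesgue_pt (h \_ `]a, b[) x ->
    lebesgue_pt (h \_ `]a, b[) y -> h x = h y.
  have [[x [xD xpt]]|N] := pselect (exists x, `]a, b[%classic x /\ lebesgue_pt (h \_ `]a, b[) x).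
    exists (h x); apply: aeS ae_pt => y ypt yD.
    by have [yx|xy|->//] := ltgtP y x; [exact: H|apply/esym/H].
  exists 0; apply: aeS ae_pt => y ypt yD; exfalso; apply: N.
  by exists y.
rewrite /= !in_itv/= => /andP[ax xb] /andP[ay yb] xy xpt ypt.
suff : step 1 * `|h x - h y| <= 0.
  by rewrite pmulr_rle0 ?step1_gt0// normr_le0 subr_eq0 => /eqP.
apply/ler_addgt0Pl => e e0; rewrite addr0.
have e20 : 0 < e / 2 by rewrite divr_gt0.
near (0 : R)^'+ => r.
have hxr : `|\int[mu]_(t in `]a, b[) (derive1 (scaled_step r^-1 x) t * h t) - step 1 * h x| <= e / 2.
  by near: r; exact: lebesgue_pt_scaled_step.
have hyr : `|\int[mu]_(t in `]a, b[) (derive1 (scaled_step r^-1 y) t * h t) - step 1 * h y| <= e / 2.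
  by near: r; exact: lebesgue_pt_scaled_step.
have r0 : 0 < r by [].
have k0 : 0 < r^-1 by rewrite invr_gt0.
have yr : y + r < b.
  by rewrite -ltrBrDl; near: r; apply: nbhs_right_lt; rewrite subr_gt0.
(* This is 0 before x and, both steps having the same height, after y + r. *)
pose phi t := -1 * scaled_step r^-1 y t + scaled_step r^-1 x t.
have tphi : test_function `]a, b[ phi.
  apply: (@test_function_of_support _ _ `[x, y + r]).
  - by apply: smoothZD; exact: smooth_scaled_step.
  - exact: segment_compact.
  - by move=> t /=; rewrite !in_itv/= => /andP[t1 t2]; apply/andP; split; lra.
  - move=> t /=; rewrite in_itv/= => /negP; rewrite negb_and -!ltNge /phi => /orP[tx|ty].
      by rewrite !scaled_step_eq0 ?mulr0 ?addr0//; lra.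
    by rewrite !scaled_step_eq1 ?invrK// ?mulN1r ?addNr//; lra.
have dphi t : derive1 phi t = -1 * derive1 (scaled_step r^-1 y) t + derive1 (scaled_step r^-1 x) t.
  apply: is_derive1.
  by apply: (@is_deriveD _ _ _ (-1 \*: scaled_step r^-1 y)); [apply: is_deriveZ|];
    apply: derivable1_is_derive; apply: smooth_derivable; exact: smooth_scaled_step.
have psih z : mu.-integrable `]a, b[ (EFin \o (fun t => derive1 (scaled_step r^-1 z) t * h t)).
  apply: (@integrable_bddM _ _ _ _ _ _ r^-1) => //.
    apply: continuous_measurable => //.
    by apply/smooth_continuous/smooth_derive1; exact: smooth_scaled_step.
  apply: aeW => t _; rewrite derive1_scaled_step ger0_norm; last first.
    by apply: mulr_ge0; [exact: ltW|exact: bump_ge0].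
  by rewrite -[leRHS]mulr1 ler_wpM2l ?bump_le1// ltW.
have := h0 _ tphi.
under eq_Rintegral do rewrite dphi mulrDl -mulrA.
rewrite RintegralZD// mulN1r => /eqP; rewrite addrC subr_eq0 => /eqP E.
rewrite E in hxr.
rewrite -[X in X * _](gtr0_norm step1_gt0) -normrM mulrBr.
move: hxr hyr; set I := Rintegral _ _ _ => hxr hyr.
rewrite (_ : _ - _ = (I - step 1 * h y) - (I - step 1 * h x)); last first.
  by rewrite opprB [RHS]addrC addrA subrK.
apply: le_trans (ler_normB _ _) _.
rewrite [leRHS]splitr; exact: (lerD hyr hxr).
Unshelve. all: by end_near. Qed.

End DuBoisReymond.

(** * Square-integrable functions *)

Section SquareIntegrable.
Context {R : realType}.
Local Notation mu := (@lebesgue_measure R).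
Variable D : set R.
Hypothesis mD : @measurable _ (measurableTypeR R) D.
Implicit Types (u v g h phi psi : R -> R).

Lemma L2P u : L2 D u <->
  measurable_fun D u /\ mu.-integrable D (EFin \o (fun x => u x ^+ 2)).
Proof.
have sqE : (EFin \o (fun x => (u \_ D) x ^+ 2)) =
    ((EFin \o (fun x => u x ^+ 2)) \_ D).
  by apply/funext => x /=; rewrite !patchE; case: ifPn => //= _; rewrite expr0n.
split=> [uL|[mu_ iu]].
  split.
    move: uL; rewrite /L2 inE => /andP[/[!inE]/= + _].
    by move/(measurable_restrictT _ mD).
  have := Lfun2_integrable_sqr uL.
  by rewrite sqE; exact: (@integrable_mkcond _ _ _ mu D _ mD).2.
have mur : measurable_fun setT (u \_ D) by apply/(measurable_restrictT _ mD).
rewrite /L2 inE; apply/andP; split; rewrite inE//=.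
rewrite /finite_norm unlock/= poweR_lty//.
have : mu.-integrable setT (EFin \o (fun x => (u \_ D) x ^+ 2)).
  by rewrite sqE; exact: (@integrable_mkcond _ _ _ mu D _ mD).1.
move=> /integrableP[_]; congr (_ < _)%E; apply: eq_integral => x _ /=.
by rewrite powR_mulrn// normrX.
Qed.

Lemma L2_measurable u : L2 D u -> measurable_fun D u.
Proof. by move=> /L2P[]. Qed.

Lemma L2_integrable_sqr u : L2 D u -> mu.-integrable D (EFin \o (fun x => u x ^+ 2)).
Proof. by move=> /L2P[]. Qed.

Lemma L2_integrableM u v : L2 D u -> L2 D v ->
  mu.-integrable D (EFin \o (fun x => u x * v x)).
Proof.
move=> /L2P[mu_ iu] /L2P[mv iv].
apply: (@ae_le_integrable _ _ _ _ _ mD _ (fun x => 1 * u x ^+ 2 + v x ^+ 2)).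
- exact: measurable_funM.
- exact: integrableZD.
- apply: aeW => x _; rewrite mul1r ler_norml.
  have := sqr_ge0 (u x + v x); have := sqr_ge0 (u x - v x).
  have := sqr_ge0 (u x); have := sqr_ge0 (v x); rewrite sqrrB sqrrD.
  by move: (u x) (v x) => y z *; apply/andP; split; lra.
Qed.

Lemma L2_bddM (M : R) u h : measurable_fun D h ->
  {ae mu, forall x, D x -> `|h x| <= M} -> L2 D u -> L2 D (fun x => h x * u x).
Proof.
move=> mh hM /L2P[mu_ iu]; apply/L2P; split; first exact: measurable_funM.
apply: (@ae_le_integrable _ _ _ _ _ mD _ (fun x => M ^+ 2 * u x ^+ 2)).
- by apply: measurable_funX; exact: measurable_funM.
- exact: integrable_scale.
- apply: aeS hM => x hM Dx.
  rewrite ger0_norm ?sqr_ge0// exprMn ler_wpM2r ?sqr_ge0//.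
  by rewrite -real_normK ?num_real// lerXn2r ?nnegrE ?hM// (le_trans _ (hM Dx)).
Qed.

Lemma L2_ZD (c : R) u v : L2 D u -> L2 D v -> L2 D (fun x => c * u x + v x).
Proof.
move=> uL vL; have [mu_ iu] := (L2P _).1 uL; have [mv iv] := (L2P _).1 vL.
apply/L2P; split; first by apply: measurable_funD => //; exact: measurable_funM.
apply: eq_integrable (integrableZD mD (c ^+ 2) iu
  (integrableZD mD (2 * c) (L2_integrableM uL vL) iv)) => //.
by move=> x _ /=; congr EFin; ring.
Qed.

Lemma sqr_integral_ge0 u : 0 <= \int[mu]_(x in D) (u x ^+ 2).
Proof. by apply: Rintegral_ge0 => x _; exact: sqr_ge0. Qed.

Lemma sqr_integralZD (c : R) u v : L2 D u -> L2 D v ->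
  \int[mu]_(x in D) ((c * u x + v x) ^+ 2) =
  c ^+ 2 * \int[mu]_(x in D) (u x ^+ 2) +
  (2 * c * \int[mu]_(x in D) (u x * v x) + \int[mu]_(x in D) (v x ^+ 2)).
Proof.
move=> uL vL; have iu := L2_integrable_sqr uL; have iv := L2_integrable_sqr vL.
have iuv := L2_integrableM uL vL.
rewrite -RintegralZD//; rewrite -RintegralZD//; last exact: integrableZD.
by apply: eq_Rintegral => x _; ring.
Qed.

(** The integral of (c u + v)^2 is a nonnegative quadratic polynomial in c. *)
Lemma cauchy_schwarz u v : L2 D u -> L2 D v ->
  (\int[mu]_(x in D) (u x * v x)) ^+ 2 <=
  \int[mu]_(x in D) (u x ^+ 2) * \int[mu]_(x in D) (v x ^+ 2).
Proof.
move=> uL vL.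
have H c : 0 <= c ^+ 2 * \int[mu]_(x in D) (u x ^+ 2) +
    (2 * c * \int[mu]_(x in D) (u x * v x) + \int[mu]_(x in D) (v x ^+ 2)).
  by rewrite -sqr_integralZD//; exact: sqr_integral_ge0.
have := sqr_integral_ge0 u; have := sqr_integral_ge0 v.
move: H; set A := \int[mu]_(x in D) (u x ^+ 2).
set B := \int[mu]_(x in D) (u x * v x); set C := \int[mu]_(x in D) (v x ^+ 2).
move: A B C => A B C H C0; rewrite le_eqVlt => /predU1P[A0|A0].
  rewrite -A0 mul0r; have [->|B0] := eqVneq B 0; first by rewrite expr0n.
  (* If u is 0 in L^2, this value of c makes the polynomial equal to -1. *)
  have := H (- (C + 1) / (2 * B)); rewrite -A0 mulr0 add0r.
  have -> : 2 * (- (C + 1) / (2 * B)) * B + C = -1 by field.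
  by rewrite ler0N1.
have := H (- B / A).
have -> : (- B / A) ^+ 2 * A + (2 * (- B / A) * B + C) = C - B ^+ 2 / A.
  by field; rewrite gt_eqF.
by rewrite subr_ge0 ler_pdivrMr// mulrC.
Qed.

End SquareIntegrable.

(** * Weak derivatives on an interval *)

Section Sobolev.
Context {R : realType}.
Local Notation mu := (@lebesgue_measure R).
Variables (a b : R).
Hypothesis ab : a < b.
Implicit Types (u v g h phi psi : R -> R).
Local Notation D := (`]a, b[%classic : set R).
Local Notation wd := (weak_derivative D).

Let mD : @measurable _ (measurableTypeR R) D. Proof. exact: measurable_itv. Qed.

Lemma L2_continuous u : continuous u -> L2 D u.
Proof.
move=> cu; apply/L2P => //; split; first exact: continuous_measurable.
apply: continuous_integrable_oo => x; rewrite /continuous_at expr2.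
rewrite (_ : (fun y => u y ^+ 2) = u * u); first by apply: cvgM; exact: cu.
by apply/funext => y; rewrite expr2.
Qed.

Lemma L2_cst (c : R) : L2 D (cst c).
Proof. by apply: L2_continuous; exact: cst_continuous. Qed.

Lemma L2_integrable u : L2 D u -> mu.-integrable D (EFin \o u).
Proof.
move=> uL; apply: eq_integrable (L2_integrableM mD (L2_cst 1) uL) => // x _.
by rewrite /= mul1r.
Qed.

Lemma Rintegral_cst_itv (c : R) : \int[mu]_(x in D) c = c * (b - a).
Proof. by rewrite Rintegral_cst//= lebesgue_measure_itv/= lte_fin ab. Qed.

Lemma sqr_Rintegral_le u : L2 D u ->
  (\int[mu]_(x in D) u x) ^+ 2 <= (b - a) * \int[mu]_(x in D) (u x ^+ 2).
Proof.
move=> uL; have := cauchy_schwarz mD (L2_cst 1) uL.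
under eq_Rintegral do rewrite mul1r.
under [in leRHS]eq_Rintegral do rewrite expr1n.
by rewrite Rintegral_cst_itv mul1r.
Qed.

Lemma L2_test phi : test_function D phi -> L2 D phi.
Proof. by move=> /test_smooth/smooth_continuous; exact: L2_continuous. Qed.

Lemma is_derive_smoothM phi psi (x : R) : smooth phi -> smooth psi ->
  is_derive x 1 (fun x => phi x * psi x) (phi x * derive1 psi x + psi x * derive1 phi x).
Proof.
move=> s1 s2.
by apply: (@is_deriveM _ _ phi); apply: derivable1_is_derive; exact: smooth_derivable.
Qed.

(** The product of two test functions vanishes at both ends of the interval. *)
Lemma test_weak_derivative phi : test_function D phi ->
  is_weak_derivative D phi (derive1 phi).
Proof.
move=> tphi; split; [exact: L2_test|exact/L2_test/test_function_derive1|move=> psi tpsi].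
have [s1 s2] := (test_smooth tphi, test_smooth tpsi).
have dE : derive1 (fun x => phi x * psi x) =
    (fun x => phi x * derive1 psi x + derive1 phi x * psi x).
  by apply/funext => x; rewrite [_ * psi x]mulrC; exact/is_derive1/is_derive_smoothM.
have s12 := smoothM s1 s2.
have := integral_derive1 ab (smooth_derivable s12)
  (smooth_continuous (smooth_derive1 s12)).
have [pL p'L] := (L2_test tphi, L2_test (test_function_derive1 tphi)).
have [qL q'L] := (L2_test tpsi, L2_test (test_function_derive1 tpsi)).
rewrite dE (RintegralD mD (L2_integrableM mD pL q'L) (L2_integrableM mD p'L qL)).
have bD : ~ D b by rewrite /= in_itv/= ltxx andbF.
have aD : ~ D a by rewrite /= in_itv/= ltxx.
by rewrite (test_eq0 tphi bD) (test_eq0 tphi aD) !mul0r subrr => /eqP; rewrite addr_eq0 => /eqP.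
Qed.

Lemma weak_derivativeZD (c : R) u v g h : is_weak_derivative D u g ->
  is_weak_derivative D v h ->
  is_weak_derivative D (fun x => c * u x + v x) (fun x => c * g x + h x).
Proof.
move=> [uL gL ug] [vL hL vh]; split; [exact: L2_ZD|exact: L2_ZD|].
move=> phi tphi.
have pL := L2_test tphi; have p'L := L2_test (test_function_derive1 tphi).
under eq_Rintegral do rewrite mulrDl -mulrA.
under [in RHS]eq_Rintegral do rewrite mulrDl -mulrA.
rewrite !RintegralZD//; [|exact: (L2_integrableM mD)..].
by rewrite ug// vh//; ring.
Qed.

(** Derivatives of test functions are test functions, so g is constant by the
du Bois-Reymond lemma; a test function of nonzero integral shows that the
constant is 0. *)
Lemma integral_test_eq0 g : L2 D g ->
  (forall phi, test_function D phi -> \int[mu]_(x in D) (g x * phi x) = 0) ->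
  {ae mu, forall x, D x -> g x = 0}.
Proof.
move=> gL g0.
have [|c gc] := du_bois_reymond (L2_integrable gL).
  move=> phi /test_function_derive1/g0.
  by under eq_Rintegral do rewrite mulrC.
suff c0 : c = 0 by apply: aeS gc => x gx /gx ->.
(* The scaled step rises over the middle third of the interval. *)
pose k := (3 / (b - a)).
have k0 : 0 < k by rewrite divr_gt0// subr_gt0.
have kV : k^-1 = (b - a) / 3 by rewrite invf_div.
pose x := a + k^-1.
have sphi : smooth (scaled_step k x) by exact: smooth_scaled_step.
have tphi : test_function D (derive1 (scaled_step k x)).
  apply: (@test_function_of_support _ _ `[x, x + k^-1]).
  - exact: smooth_derive1.
  - exact: segment_compact.
  - move=> t /=; rewrite !in_itv/= => /andP[xt tx].
    have ab0 : 0 < b - a by rewrite subr_gt0.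
    rewrite (lt_le_trans _ xt) ?ltrDl ?invr_gt0//= (le_lt_trans tx)//.
    by rewrite /x kV -addrA -ltrBrDl; lra.
  - move=> t /=; rewrite in_itv/= => /negP; rewrite negb_and -!ltNge derive1_scaled_step => tx.
    rewrite bump_eq0 ?mulr0// -mulrBr; case/orP: tx => [tx|tx]; [left|right].
      by rewrite pmulr_rle0// subr_le0 ltW.
    by rewrite -ler_pdivrMl// mulr1 lerBrDl ltW.
have := g0 _ tphi.
have cphi := smooth_continuous (smooth_derive1 sphi).
rewrite (ae_eq_Rintegral mD (g := fun t => c * derive1 (scaled_step k x) t)); last 3 first.
- by apply: measurable_funM; [exact: L2_measurable|exact: continuous_measurable].
- by apply: measurable_funM => //; exact: continuous_measurable.
- by apply: aeS gc => t gt Dt; rewrite gt.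
rewrite RintegralZl//; last exact: continuous_integrable_oo.
rewrite (integral_derive1 ab (smooth_derivable sphi) cphi).
have ab0 : 0 < b - a by rewrite subr_gt0.
rewrite scaled_step_eq1//; last by rewrite /x kV -addrA -lerBrDl; lra.
rewrite scaled_step_eq0 ?subr0//; last by rewrite /x lerDl invr_ge0 ltW.
by move/eqP; rewrite mulf_eq0 (gt_eqF step1_gt0) orbF => /eqP.
Qed.

Lemma weak_derivative_unique u g h : is_weak_derivative D u g ->
  is_weak_derivative D u h -> {ae mu, forall x, D x -> g x = h x}.
Proof.
move=> ug uh; have [uL gL ugE] := ug; have [_ hL uhE] := uh.
have : {ae mu, forall x, D x -> -1 * g x + h x = 0}.
  apply: integral_test_eq0; first exact: L2_ZD.
  move=> phi tphi; under eq_Rintegral do rewrite mulrDl -mulrA.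
  have pL := L2_test tphi.
  rewrite RintegralZD//; [|exact: (L2_integrableM mD)..].
  have := ugE _ tphi; rewrite uhE// => /eqP; rewrite eqr_opp => /eqP ->.
  by rewrite mulN1r addNr.
apply: aeS => x H /H /eqP; rewrite mulN1r addrC subr_eq0 => /eqP ->//.
Qed.

Lemma weak_derivativeP u : H1 D u -> is_weak_derivative D u (wd u).
Proof. by move=> [g ug]; exact: (@getPex _ [set g | is_weak_derivative D u g] (ex_intro _ g ug)). Qed.

Lemma weak_derivative_eq u g : is_weak_derivative D u g ->
  {ae mu, forall x, D x -> wd u x = g x}.
Proof.
move=> ug; apply: weak_derivative_unique (ug).
by apply: weak_derivativeP; exists g.
Qed.

Lemma H1_L2 u : H1 D u -> L2 D u.
Proof. by move=> [g []]. Qed.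

Lemma L2_wd u : H1 D u -> L2 D (wd u).
Proof. by move=> /weak_derivativeP[]. Qed.

Lemma sqr_H1norm u : H1norm D u ^+ 2 =
  \int[mu]_(x in D) (u x ^+ 2) + \int[mu]_(x in D) (wd u x ^+ 2).
Proof. by rewrite sqr_sqrtr// addr_ge0// sqr_integral_ge0. Qed.

Lemma H1norm_ge0 u : 0 <= H1norm D u.
Proof. exact: sqrtr_ge0. Qed.

Lemma ae_sqr_integral u v : measurable_fun D u -> measurable_fun D v ->
  {ae mu, forall x, D x -> u x = v x} ->
  \int[mu]_(x in D) (u x ^+ 2) = \int[mu]_(x in D) (v x ^+ 2).
Proof.
move=> mu_ mv uv; apply: ae_eq_Rintegral => //; [exact: measurable_funX..|].
by apply: aeS uv => x uv Dx; rewrite uv.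
Qed.

(** The distance is measured with the derivatives of u and of phi separately,
whereas [H1norm] of the difference involves a weak derivative chosen for the
difference. *)
Definition test_approx u := forall e, 0 < e -> exists phi, [/\ test_function D phi,
  \int[mu]_(x in D) ((u x - phi x) ^+ 2) <= e &
  \int[mu]_(x in D) ((wd u x - derive1 phi x) ^+ 2) <= e].

(** By uniqueness the weak derivative chosen for the difference agrees almost
everywhere with the difference of the derivatives. *)
Lemma sqr_H1normB u phi : H1 D u -> test_function D phi ->
  H1norm D (u \- phi) ^+ 2 = \int[mu]_(x in D) ((u x - phi x) ^+ 2) +
    \int[mu]_(x in D) ((wd u x - derive1 phi x) ^+ 2).
Proof.
move=> hu tphi; rewrite sqr_H1norm; congr (_ + _).
have upE : u \- phi = fun x => -1 * phi x + u x.
  by apply/funext => x; rewrite mulN1r addrC.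
have W := weak_derivativeZD (-1) (test_weak_derivative tphi) (weak_derivativeP hu).
rewrite -upE in W.
have [_ dL _] := weak_derivativeP (ex_intro _ _ W).
rewrite (ae_sqr_integral _ _ (weak_derivative_eq W)); last 2 first.
- exact: L2_measurable dL.
- by have [_ gL _] := W; exact: L2_measurable gL.
by apply: eq_Rintegral => x _; rewrite mulN1r addrC.
Qed.

(** A form of membership in H^1_0 in which sums and multiples of approximations
can be taken directly. *)
Lemma H10P u : H10 D u <-> H1 D u /\ test_approx u.
Proof.
split=> [[hu [phi [tphi u0]]]|[hu au]]; split=> //.
  move=> e e0.
  have s0 : 0 < Num.sqrt e by rewrite sqrtr_gt0.
  have /cvgrPdist_lt/(_ _ s0)[k _ /(_ k (leqnn k))] := u0.
  rewrite sub0r normrN ger0_norm ?H1norm_ge0// => ke.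
  exists (phi k).
  have : H1norm D (u \- phi k) ^+ 2 <= e.
    by rewrite -[leRHS]sqr_sqrtr ?(ltW e0)// lerXn2r ?nnegrE ?H1norm_ge0 ?sqrtr_ge0 ?ltW.
  rewrite sqr_H1normB// => H; split=> //; apply: le_trans H.
    by rewrite lerDl sqr_integral_ge0.
  by rewrite lerDr sqr_integral_ge0.
have e0 k : 0 < k.+1%:R^-1 ^+ 2 / 2 :> R by rewrite divr_gt0// exprn_gt0// invr_gt0.
pose phi k := projT1 (cid (au _ (e0 k))).
have phiP k := projT2 (cid (au _ (e0 k))).
exists phi; split; first by move=> k; have [] := phiP k.
apply: (@squeeze_cvgr _ _ _ _ (cst 0) (@harmonic R)); [|exact: cvg_cst|exact: cvg_harmonic].
near=> k; rewrite H1norm_ge0/=.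
have [tp p1 p2] := phiP k.
rewrite -(@ler_pXn2r _ 2) ?nnegrE ?H1norm_ge0// ?invr_ge0//.
by rewrite sqr_H1normB// [leRHS]splitr lerD.
Unshelve. all: by end_near. Qed.

Lemma H10_H1 u : H10 D u -> H1 D u.
Proof. by case. Qed.

Lemma wd_ZD (c : R) u v : H1 D u -> H1 D v ->
  {ae mu, forall x, D x -> wd (fun x => c * u x + v x) x = c * wd u x + wd v x}.
Proof.
move=> hu hv; apply: weak_derivative_eq.
by apply: weak_derivativeZD; exact: weak_derivativeP.
Qed.

Lemma H1_ZD (c : R) u v : H1 D u -> H1 D v -> H1 D (fun x => c * u x + v x).
Proof.
move=> hu hv; exists (fun x => c * wd u x + wd v x).
by apply: weak_derivativeZD; exact: weak_derivativeP.
Qed.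

Lemma H1_test phi : test_function D phi -> H1 D phi.
Proof. by move=> tphi; exists (derive1 phi); exact: test_weak_derivative. Qed.

Lemma wd_test phi : test_function D phi ->
  {ae mu, forall x, D x -> wd phi x = derive1 phi x}.
Proof. by move=> tphi; exact/weak_derivative_eq/test_weak_derivative. Qed.

Lemma H10_test phi : test_function D phi -> H10 D phi.
Proof.
move=> tphi; apply/H10P; split; first exact: H1_test.
move=> e e0; exists phi; split => //.
  under eq_Rintegral do rewrite subrr expr0n.
  by rewrite Rintegral_cst_itv mul0r ltW.
have mp : measurable_fun D (derive1 phi) by apply: L2_measurable => //; exact/L2_test/test_function_derive1.
rewrite (ae_sqr_integral (v := fun=> 0)) //.
- under eq_Rintegral do rewrite expr0n.
  by rewrite Rintegral_cst_itv mul0r ltW.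
- by apply: measurable_funB => //; apply: L2_measurable => //; exact/L2_wd/H1_test.
- by apply: aeS (wd_test tphi) => x E Dx; rewrite E// subrr.
Qed.

Lemma L2B u v : L2 D u -> L2 D v -> L2 D (fun x => u x - v x).
Proof.
move=> uL vL; have := L2_ZD mD (-1) vL uL; congr (L2 _ _).
by apply/funext => x; rewrite mulN1r addrC.
Qed.

Lemma sqr_integralD_le (c : R) u v : L2 D u -> L2 D v ->
  \int[mu]_(x in D) ((c * u x + v x) ^+ 2) <=
  2 * (c ^+ 2 * \int[mu]_(x in D) (u x ^+ 2) + \int[mu]_(x in D) (v x ^+ 2)).
Proof.
move=> uL vL.
rewrite mulrDr mulrA -[X in _ + X]RintegralZl//; last exact: L2_integrable_sqr.
rewrite -RintegralZD//; [|exact: L2_integrable_sqr|]; last first.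
  by apply: integrable_scale => //; exact: L2_integrable_sqr.
apply: le_Rintegral => //.
- by apply: L2_integrable_sqr => //; exact: L2_ZD.
- apply: integrableZD => //; first exact: L2_integrable_sqr.
  by apply: integrable_scale => //; exact: L2_integrable_sqr.
- move=> x _; rewrite -subr_ge0.
  rewrite (_ : _ - _ = (c * u x - v x) ^+ 2) ?sqr_ge0//; ring.
Qed.

Lemma sqr_integral_approx u v : L2 D u -> L2 D v ->
  \int[mu]_(x in D) (v x ^+ 2) <= 2 * (\int[mu]_(x in D) ((u x - v x) ^+ 2) +
     \int[mu]_(x in D) (u x ^+ 2)).
Proof.
move=> uL vL; have := sqr_integralD_le (-1) (L2B uL vL) uL.
under eq_Rintegral do rewrite mulN1r opprB subrK.
by rewrite sqrrN expr1n mul1r.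
Qed.

Lemma H10_ZD (c : R) u v : H10 D u -> H10 D v -> H10 D (fun x => c * u x + v x).
Proof.
move=> /H10P[hu au] /H10P[hv av]; apply/H10P; split; first exact: H1_ZD.
move=> e e0.
have K0 : 0 < 2 * (c ^+ 2 + 1) by rewrite mulr_gt0// ltr_wpDl// sqr_ge0.
have d0 : 0 < e / (2 * (c ^+ 2 + 1)) by rewrite divr_gt0.
have [phi [tphi p1 p2]] := au _ d0; have [psi [tpsi q1 q2]] := av _ d0.
have small (x y : R) : x <= e / (2 * (c ^+ 2 + 1)) -> y <= e / (2 * (c ^+ 2 + 1)) ->
    2 * (c ^+ 2 * x + y) <= e.
  move=> xe ye; rewrite (_ : e = 2 * (c ^+ 2 * (e / (2 * (c ^+ 2 + 1))) + e / (2 * (c ^+ 2 + 1)))).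
    by rewrite ler_wpM2l// lerD// ler_wpM2l// sqr_ge0.
  by field; rewrite gt_eqF// ltr_wpDl// sqr_ge0.
exists (fun x => c * phi x + psi x); split; first exact: test_functionZD.
  rewrite (_ : Rintegral _ _ _ = \int[mu]_(x in D) ((c * (u x - phi x) + (v x - psi x)) ^+ 2)); last first.
    by apply: eq_Rintegral => x _; ring.
  apply: le_trans (sqr_integralD_le _ _ _) (small _ _ p1 q1).
  - by apply: L2B; [exact: H1_L2|exact: L2_test].
  - by apply: L2B; [exact: H1_L2|exact: L2_test].
have L1 : L2 D (fun x => wd u x - derive1 phi x).
  by apply: L2B; [exact: L2_wd|exact/L2_test/test_function_derive1].
have L3 : L2 D (fun x => wd v x - derive1 psi x).
  by apply: L2B; [exact: L2_wd|exact/L2_test/test_function_derive1].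
have dE x : derive1 (fun x => c * phi x + psi x) x = c * derive1 phi x + derive1 psi x.
  apply: is_derive1; apply: (@is_deriveD _ _ _ (c \*: phi)).
    exact/is_deriveZ/derivable1_is_derive/(smooth_derivable (test_smooth tphi)).
  exact/derivable1_is_derive/(smooth_derivable (test_smooth tpsi)).
rewrite (ae_sqr_integral (v := fun x => c * (wd u x - derive1 phi x) +
    (wd v x - derive1 psi x))).
- exact: le_trans (sqr_integralD_le _ L1 L3) (small _ _ p2 q2).
- apply: measurable_funB; first by apply: L2_measurable => //; exact/L2_wd/H1_ZD.
  by apply: L2_measurable => //; apply: L2_test; apply: test_function_derive1; exact: test_functionZD.
- by apply: L2_measurable => //; exact: L2_ZD.
- by apply: aeS (wd_ZD c hu hv) => x E Dx; rewrite E// dE; ring.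
Qed.

(** This holds for test functions, which vanish at both ends, and is stable under
convergence of the derivatives in L^2. *)
Lemma integral_wd_eq0 u : H10 D u -> \int[mu]_(x in D) wd u x = 0.
Proof.
move=> /H10P[hu au]; apply/eqP; rewrite -[_ == 0]sqrf_eq0 eq_le sqr_ge0 andbT.
have ab0 : 0 < b - a by rewrite subr_gt0.
apply/ler_addgt0Pl => e e0; rewrite addr0.
have [phi [tphi _ p]] := au _ (divr_gt0 e0 ab0).
have bD : ~ D b by rewrite /= in_itv/= ltxx andbF.
have aD : ~ D a by rewrite /= in_itv/= ltxx.
have sphi := test_smooth tphi.
have := integral_derive1 ab (smooth_derivable sphi) (smooth_continuous (smooth_derive1 sphi)).
rewrite (test_eq0 tphi bD) (test_eq0 tphi aD) subrr => phi0.
have p'L := L2_test (test_function_derive1 tphi).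
rewrite -[X in X ^+ 2]subr0 -phi0 -RintegralB//; [|exact/L2_integrable/L2_wd|exact: L2_integrable].
apply: le_trans (sqr_Rintegral_le _) _; first by apply: L2B => //; exact: L2_wd.
by rewrite -ler_pdivlMl// mulrC.
Qed.

End Sobolev.

Section Poincare.
Context {R : realType}.
Local Notation mu := (@lebesgue_measure R).
Variables (a b : R).
Hypothesis ab : a < b.
Implicit Types (u v g h phi psi : R -> R).
Local Notation D := (`]a, b[%classic : set R).
Local Notation wd := (weak_derivative D).

Let mD : @measurable _ (measurableTypeR R) D. Proof. exact: measurable_itv. Qed.

(** At each point phi is the integral of its derivative from the left end, to
which the Cauchy-Schwarz inequality applies. *)
Lemma poincare_test phi : test_function D phi ->
  \int[mu]_(x in D) (phi x ^+ 2) <=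
  (b - a) ^+ 2 * \int[mu]_(x in D) (derive1 phi x ^+ 2).
Proof.
move=> tphi; have sphi := test_smooth tphi.
have cphi' := smooth_continuous (smooth_derive1 sphi).
have pL := L2_test tphi.
have p'L := L2_test (test_function_derive1 tphi).
set I := \int[mu]_(x in D) (derive1 phi x ^+ 2).
have aD : ~ D a by rewrite /= in_itv/= ltxx.
have H x : D x -> phi x ^+ 2 <= (b - a) * I.
  rewrite /= in_itv/= => /andP[ax xb].
  have := integral_derive1 ax (smooth_derivable sphi) cphi'.
  rewrite (test_eq0 tphi aD) subr0 => <-.
  apply: le_trans (sqr_Rintegral_le ax (L2_continuous a x cphi')) _.
  apply: ler_pM; rewrite ?subr_ge0 ?(ltW ax)//.
  - exact: sqr_integral_ge0.
  - by rewrite lerD2r ltW.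
  - apply: ge0_subset_Rintegral => //; last exact: L2_integrable_sqr.
      by apply: subset_itvl; rewrite bnd_simp ltW.
    by move=> t; exact: sqr_ge0.
rewrite (_ : _ ^+ 2 * I = (b - a) * I * (b - a)); last by ring.
rewrite -(Rintegral_cst_itv ab); apply: le_Rintegral => //.
- exact: L2_integrable_sqr.
- by apply: continuous_integrable_oo; exact: cst_continuous.
Qed.

(** The factor 4 comes from two uses of (s + t)^2 <= 2 s^2 + 2 t^2, to pass from u
to a nearby test function and from its derivative back to that of u. *)
Lemma poincare u : H10 D u -> H1norm D u ^+ 2 <=
  (1 + 4 * (b - a) ^+ 2) * \int[mu]_(x in D) (wd u x ^+ 2).
Proof.
move=> /(H10P ab)[hu au]; rewrite sqr_H1norm mulrDl mul1r addrC lerD2l.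
have uL := H1_L2 hu; have u'L := L2_wd hu.
set I := \int[mu]_(x in D) (wd u x ^+ 2).
apply/ler_addgt0Pl => e e0.
have K0 : 0 < 2 + 4 * (b - a) ^+ 2.
  by rewrite ltr_wpDr// mulr_ge0// sqr_ge0.
have [phi [tphi p1 p2]] := au _ (divr_gt0 e0 K0).
have pL := L2_test tphi; have p'L := L2_test (test_function_derive1 tphi).
have H1 := sqr_integral_approx pL uL.
have H2 := sqr_integral_approx u'L p'L.
have H3 := poincare_test tphi.
move: H1 H2 H3 p1 p2.
have -> : \int[mu]_(x in D) ((phi x - u x) ^+ 2) = \int[mu]_(x in D) ((u x - phi x) ^+ 2).
  by apply: eq_Rintegral => x _; rewrite -sqrrN opprB.
set A := \int[mu]_(x in D) (u x ^+ 2).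
set B := \int[mu]_(x in D) ((u x - phi x) ^+ 2).
set C := \int[mu]_(x in D) (phi x ^+ 2).
set E := \int[mu]_(x in D) (derive1 phi x ^+ 2).
set F := \int[mu]_(x in D) ((wd u x - derive1 phi x) ^+ 2).
set L := (b - a) ^+ 2.
have L0 : 0 <= L by exact: sqr_ge0.
rewrite -/L in K0 *.
move=> H1 H2 H3 p1 p2.
have eE : e = (2 + 4 * L) * (e / (2 + 4 * L)) by rewrite mulrC divfK// gt_eqF.
rewrite {1}eE; move: (e / _) p1 p2 => d p1 p2.
have : L * E <= L * (2 * (d + I)).
  rewrite ler_wpM2l//; apply: le_trans H2 _.
  by rewrite ler_wpM2l// lerD2r.
move: H1 H3 p1; clear; move: A B C E L d I => A B C E L d I.
have -> : L * (2 * (d + I)) = 2 * (L * d) + 2 * (L * I) by ring.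
have -> : (2 + 4 * L) * d + 4 * L * I = 2 * d + 4 * (L * d) + 4 * (L * I) by ring.
move: (L * d) (L * I) (L * E) => *; lra.
Qed.

End Poincare.

(** * Bounded functionals on the space of trial functions *)

Section DirichletPrinciple.
Context {R : realType}.
Local Notation mu := (@lebesgue_measure R).
Variables (a b : R).
Hypothesis ab : a < b.
Implicit Types (u v w : R -> R).
Local Notation D := (`]a, b[%classic : set R).
Local Notation wd := (weak_derivative D).

Let mD : @measurable _ (measurableTypeR R) D. Proof. exact: measurable_itv. Qed.

Definition energy u : R := \int[mu]_(x in D) (wd u x ^+ 2).

Lemma energy_ge0 u : 0 <= energy u.
Proof. exact: sqr_integral_ge0. Qed.

Lemma energyZD (c : R) u v : H1 D u -> H1 D v ->
  energy (fun x => c * u x + v x) =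
  c ^+ 2 * energy u + (2 * c * \int[mu]_(x in D) (wd u x * wd v x) + energy v).
Proof.
move=> hu hv; rewrite -(sqr_integralZD mD); [|exact: L2_wd..].
apply: ae_sqr_integral.
- by apply: L2_measurable => //; exact/L2_wd/H1_ZD.
- by apply: L2_measurable => //; apply: L2_ZD => //; exact: L2_wd.
- exact: wd_ZD.
Qed.

(** The Dirichlet principle.  If v minimises J v = energy v - 2 F v up to s^2,
comparing J v with J (v + s w) and J (v - s w) shows that the first variation
of J at v in the direction w is at most of order s. *)
Lemma approx_riesz (F : (R -> R) -> R) : H_minus1 D F -> forall s, 0 < s ->
  exists v, H10 D v /\ forall w, H10 D w ->
    `|F w - \int[mu]_(x in D) (wd w x * wd v x)| <= s * (energy w + 1).
Proof.
move=> [Flin [C FC]] s s0.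
pose K := 1 + 4 * (b - a) ^+ 2.
have K0 : 0 < K by rewrite ltr_pwDl// mulr_ge0// sqr_ge0.
pose J v := energy v - 2 * F v.
pose E := [set J v | v in [set v | H10 D v]].
(* By the Poincare inequality F is bounded in terms of the energy alone. *)
have Jlow v : H10 D v -> - (C ^+ 2 * K) <= J v.
  move=> hv; rewrite -subr_ge0 -(pmulr_rge0 _ K0).
  have := poincare ab hv; rewrite -/K -/(energy v).
  have := FC _ hv; rewrite ler_norml => /andP[_].
  rewrite /J; move: (H1norm _ _) (energy _) (F v) => N q f fN NK.
  apply: le_trans (sqr_ge0 (N - C * K)) _; rewrite sqrrB.
  have fNK : K * f <= K * (C * N) by rewrite ler_wpM2l// ltW.
  rewrite (_ : K * _ = K * q - 2 * (K * f) + (C * K) ^+ 2); last by ring.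
  rewrite (_ : N * (C * K) = K * (C * N)); last by ring.
  by move: (K * f) (K * (C * N)) (K * q) (N ^+ 2) ((C * K) ^+ 2) fNK NK => *; lra.
have hE : has_inf E.
  split; first by exists (J (fun=> 0)); exists (fun=> 0) => //; exact/H10_test/test_function0.
  by exists (- (C ^+ 2 * K)) => _ [v hv <-]; exact: Jlow.
have ss0 : 0 < s ^+ 2 by rewrite exprn_gt0.
have [_ [v hv <-] Jv] := inf_adherent ss0 hE.
exists v; split => // w hw.
have main t : 2 * t * (F w - \int[mu]_(x in D) (wd w x * wd v x)) <=
    t ^+ 2 * energy w + s ^+ 2.
  set I := Rintegral _ _ _.
  have JE : J (fun x => t * w x + v x) =
      t ^+ 2 * energy w + (2 * t * I + energy v) - 2 * (t * F w + F v).
    by rewrite /J (energyZD t (H10_H1 hw) (H10_H1 hv)) (Flin t w v hw hv).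
  have : J v < J (fun x => t * w x + v x) + s ^+ 2.
    apply: lt_le_trans Jv _; rewrite lerD2r; apply: (ge_inf hE.2).
    exists (fun x => t * w x + v x); last by [].
    exact: (H10_ZD ab t hw hv).
  rewrite JE /J; move: {JE} I (energy v) (F v) (F w) (energy w) => I ev fv fw q /ltW.
  rewrite -subr_ge0 => H; rewrite -subr_ge0.
  by apply: le_trans H _; rewrite le_eqVlt; apply/orP; left; apply/eqP; ring.
set I := Rintegral _ _ _ in main *.
rewrite -(ler_pM2l (_ : 0 < 2 * s)) ?mulr_gt0//.
have H q : s ^+ 2 * q + s ^+ 2 <= 2 * s * (s * (q + 1)) = (0 <= s ^+ 2 * (q + 1)).
  by rewrite -subr_ge0; congr (_ <= _); ring.
have sq0 : 0 <= s ^+ 2 * (energy w + 1).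
  by rewrite mulr_ge0 ?(ltW ss0)// addr_ge0// energy_ge0.
have [h0|h0] := leP 0 (F w - I).
  by rewrite (ger0_norm h0); apply: le_trans (main s) _; rewrite H.
rewrite (ltr0_norm h0); have := main (- s); rewrite sqrrN mulrN mulNr -mulrN => /le_trans; apply.
by rewrite H.
Qed.

End DirichletPrinciple.

(** * Affine changes of variables *)

Section Scaling.
Context {R : realType}.
Local Notation mu := (@lebesgue_measure R).
Local Notation mR := (measurableTypeR R).
Implicit Types (f : R -> R) (k c x y : R).

Lemma measurable_affine k c : measurable_fun [set: mR] (fun t : mR => k * t + c : mR).
Proof. by apply: measurable_funD => //; exact: measurable_funM. Qed.

Lemma preimage_affine_oc k c x y : 0 < k ->
  (fun t => k * t + c) @^-1` `]x, y] = `](x - c) / k, (y - c) / k]%classic.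
Proof.
move=> k0; apply/seteqP; split => t /=; rewrite !in_itv/=.
  by rewrite ltr_pdivrMr// ler_pdivlMr// mulrC ltrBlDr lerBrDr.
by rewrite ltr_pdivrMr// ler_pdivlMr// mulrC ltrBlDr lerBrDr.
Qed.

Lemma preimage_affine_oo k c x y : 0 < k ->
  (fun t => k * t + c) @^-1` `]k * x + c, k * y + c[ = `]x, y[%classic.
Proof.
by move=> k0; apply/seteqP; split => t /=; rewrite !in_itv/= !ltrD2r !ltr_pM2l.
Qed.

(** Rescaled by k, the image measure agrees with Lebesgue measure on half-open
intervals, hence everywhere. *)
Lemma lebesgue_measure_affine k c (A : set mR) : 0 < k -> measurable A ->
  mu ((fun t => k * t + c) @^-1` A) = (k^-1%:E * mu A)%E.
Proof.
move=> k0 mA.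
pose phi (t : mR) : mR := k * t + c.
have mphi : measurable_fun setT phi := measurable_affine k c.
pose push := measure_function_pushforward__canonical__measure_function_Measure mu mphi.
pose nu := measure_function_mscale__canonical__measure_function_Measure (NngNum (ltW k0)) push.
have -> : mu A = nu A.
  apply: lebesgue_measure_unique => // X [[x y] _ <-].
  rewrite /nu/= /mscale/= /pushforward/= preimage_affine_oc// !lebesgue_measure_itv/=.
  rewrite !lte_fin ltr_pM2r ?invr_gt0// ltrD2r; case: ifPn => _; last by rewrite mule0.
  by rewrite -!EFinB -EFinM; congr EFin; field; rewrite gt_eqF.
rewrite /nu/= /mscale/= /pushforward/= muleA -EFinM mulVf ?gt_eqF// mul1e//.
Qed.

Lemma ge0_integral_affine k c f (D : set mR) : 0 < k -> measurable D ->
  measurable_fun D f -> (forall x, 0 <= f x) ->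
  (\int[mu]_(t in (fun t => (k * t + c)%R) @^-1` D) (f (k * t + c)%R)%:E =
   k^-1%:E * \int[mu]_(x in D) (f x)%:E)%E.
Proof.
move=> k0 mD mf f0.
pose phi (t : mR) : mR := k * t + c.
have mphi : measurable_fun setT phi := measurable_affine k c.
have kV0 : 0 <= k^-1 by rewrite invr_ge0 ltW.
have -> : (k^-1%:E * \int[mu]_(x in D) (f x)%:E = \int[mscale (NngNum kV0) mu]_(x in D) (f x)%:E)%E.
  by rewrite ge0_integral_mscale//; [exact/measurable_EFinP|move=> x _; rewrite lee_fin].
have mEf : measurable_fun D (fun x => (f x)%:E) by exact/measurable_EFinP.
have := @ge0_integral_pushforward _ _ mR mR R phi mphi mu D (EFin \o f) mD mEf.
move=> <- //; last by move=> x _; rewrite lee_fin.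
apply: eq_measure_integral => A mA _.
rewrite /pushforward /mscale/=; exact: (lebesgue_measure_affine c k0 mA).
Qed.

Lemma fineZ (r : R) (z : \bar R) : 0 < r -> fine (r%:E * z)%E = r * fine z.
Proof.
move=> r0; case: z => [z| |].
- by rewrite -EFinM.
- by rewrite gt0_muley ?lte_fin//= mulr0.
- by rewrite gt0_muleNy ?lte_fin//= mulr0.
Qed.

(** Integrability is not asked of f: for a nonnegative function the two extended
integrals are proportional, and an infinite one has real value 0 on both sides. *)
Lemma Rintegral_affine k c f x y : 0 < k -> measurable_fun [set: mR] f ->
  (forall x, 0 <= f x) ->
  \int[mu]_(t in `]x, y[) f (k * t + c) =
  k^-1 * \int[mu]_(t in `]k * x + c, k * y + c[) f t.
Proof.
move=> k0 mf f0; rewrite -(@preimage_affine_oo k c)// /Rintegral.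
rewrite ge0_integral_affine//; last exact: measurable_funTS.
by rewrite fineZ// invr_gt0.
Qed.

Lemma ae_affine k c (Q : R -> Prop) : 0 < k ->
  {ae mu, forall x, Q x} -> {ae mu, forall x, Q (k * x + c)}.
Proof.
move=> k0 [A [mA A0 QA]].
exists ((fun t => k * t + c) @^-1` A); split.
- by rewrite -[X in measurable X]setTI; exact: measurable_affine.
- by rewrite lebesgue_measure_affine// A0 mule0.
- by move=> t /= /QA.
Qed.

Lemma Rintegral_split f x y z : x <= y -> y <= z ->
  mu.-integrable `]x, z[ (EFin \o f) ->
  \int[mu]_(t in `]x, z[) f t =
  \int[mu]_(t in `]x, y[) f t + \int[mu]_(t in `]y, z[) f t.
Proof.
move=> xy; rewrite le_eqVlt => /predU1P[->|yz] fi.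
  by rewrite [X in _ + X](_ : _ = 0) ?addr0// set_itvoo0 Rintegral_set0.
have fxy : mu.-integrable `]x, y[ (EFin \o f).
  by apply: integrableS fi => //; apply: subset_itvl; rewrite bnd_simp ltW.
rewrite -(@Rintegral_itvB _ f (BRight x) (BLeft z) y)//.
by rewrite (Rintegral_itv_bndo_bndc fxy) addrC subrK.
Qed.

End Scaling.

(** * Bounded families with vanishing averages *)

Section WeakStar.
Context {R : realType}.
Local Notation mu := (@lebesgue_measure R).
Variables (a b : R).
Hypothesis ab : a < b.
Local Notation D := (`]a, b[%classic : set R).
Implicit Types (g h : R -> R).

Let mD : @measurable _ (measurableTypeR R) D. Proof. exact: measurable_itv. Qed.

Lemma segment_unif_continuous h w : continuous h -> 0 < w ->
  exists2 d, 0 < d & forall x y, `[a, b]%classic x -> `|x - y| < d -> `|h x - h y| <= w.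
Proof.
move=> ch w0.
have /compact_near_coveringP cov := @segment_compact R a b.
have : \forall d \near 0^'+, `[a, b]%classic `<=` (fun x : R => forall y, `|x - y| < d -> `|h x - h y| <= w).
  apply: cov => x _.
  have w20 : 0 < w / 2 by rewrite divr_gt0.
  have /cvgrPdist_lt/(_ _ w20)/nbhs_ballP[r /= r0 hr] := ch x.
  have r20 : 0 < r / 2 by rewrite divr_gt0.
  near=> x' d => y x'y.
  have xx' : `|x - x'| < r / 2.
    by near: x'; apply: nbhsx_ballx.
  have dr : d < r / 2 by near: d; exact: nbhs_right_lt.
  have H1 : `|h x - h x'| < w / 2.
    by apply: hr; rewrite /ball/=; apply: lt_trans xx' _; rewrite ltr_pdivrMr// ltr_pMr// ltr1n.
  have H2 : `|h x - h y| < w / 2.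
    apply: hr; rewrite /ball/= (_ : x - y = (x - x') + (x' - y)); last by rewrite addrA subrK.
    apply: le_lt_trans (ler_normD _ _) _.
    by rewrite [ltRHS]splitr ltrD//; exact: lt_trans dr.
  rewrite (_ : h x' - h y = (h x - h y) - (h x - h x')); last by ring.
  apply: le_trans (ler_normB _ _) _.
  by rewrite [leRHS]splitr; apply: lerD; exact: ltW.
move=> H; near (0 : R)^'+ => d.
exists d; first by [].
move=> x y xab; move: (x) xab y; near: d; exact: H.
Unshelve. all: by end_near. Qed.

Variable fam : R -> R -> R.
Variable M : R.
Hypothesis M0 : 0 < M.
Hypothesis mfam : forall eps, 0 < eps -> measurable_fun [set: R] (fam eps).
Hypothesis famM : forall eps, 0 < eps -> {ae mu, forall x, `|fam eps x| <= M}.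
Hypothesis fam0 : forall x y, x < y ->
  \int[mu]_(t in `]x, y[) fam eps t @[eps --> 0^'+] --> 0.

Lemma family_integrableM (E : set R) eps g : 0 < eps -> @measurable _ (measurableTypeR R) E ->
  mu.-integrable E (EFin \o g) ->
  mu.-integrable E (EFin \o (fun x => fam eps x * g x)).
Proof.
move=> e0 mE; apply: (@integrable_bddM _ _ _ _ _ mE M).
  by apply: measurable_funTS; exact: mfam.
by apply: aeS (famM e0) => x H _.
Qed.

Lemma family_integral_le (E : set R) eps g : 0 < eps -> @measurable _ (measurableTypeR R) E ->
  mu.-integrable E (EFin \o g) ->
  `|\int[mu]_(x in E) (fam eps x * g x)| <= M * \int[mu]_(x in E) `|g x|.
Proof.
move=> e0 mE gi; apply: (@Rintegral_bddM_le _ _ _ _ _ mE M) => //.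
  by apply: measurable_funTS; exact: mfam.
by apply: aeS (famM e0) => x H _.
Qed.

(** On a fine subdivision h is nearly constant on each piece: the error is
absorbed by the uniform bound M, and the constants are paired with a family
whose integrals vanish in the limit. *)
Lemma family_cvg_continuous h : continuous h ->
  \int[mu]_(t in D) (fam eps t * h t) @[eps --> 0^'+] --> 0.
Proof.
move=> ch; apply/cvgr0Pnorm_le => e e0.
have ba0 : 0 < b - a by rewrite subr_gt0.
(* An oscillation of h for which the total error M w (b - a) is e / 2. *)
have w0 : 0 < e / 2 / (M * (b - a)) by rewrite !divr_gt0// mulr_gt0.
have [d d0 hd] := segment_unif_continuous ch w0.
set w := e / 2 / _ in w0 hd.
have [n nd] : exists n, (b - a) / n.+1%:R < d.
  have nP := archi_boundP (ltW (divr_gt0 ba0 d0)).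
  exists (Num.bound ((b - a) / d)); rewrite ltr_pdivrMr// -ltr_pdivrMl// mulrC.
  by apply: (lt_le_trans nP); rewrite ler_nat.
pose x_ i := a + i%:R * ((b - a) / n.+1%:R).
have step0 : 0 < (b - a) / n.+1%:R by rewrite divr_gt0.
have x0 : x_ 0%N = a by rewrite /x_ mul0r addr0.
have xn : x_ n.+1 = b by rewrite /x_ mulrC divfK ?pnatr_eq0// addrC subrK.
have xS i : x_ i < x_ i.+1 by rewrite /x_ ltrD2l ltr_pM2r// ltr_nat.
have xSB i : x_ i.+1 - x_ i = (b - a) / n.+1%:R.
  by rewrite /x_ -addn1 natrD; ring.
have x_le i j : (i <= j)%N -> x_ i <= x_ j by move=> ij; rewrite /x_ lerD2l ler_pM2r// ler_nat.
have hi x y : mu.-integrable `]x, y[ (EFin \o h) by exact: continuous_integrable_oo.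
suff H i : (i <= n.+1)%N -> forall eta, 0 < eta -> \forall eps \near 0^'+,
    `|\int[mu]_(t in `]a, x_ i[) (fam eps t * h t)| <= M * w * (x_ i - a) + eta.
  have e20 : 0 < e / 2 by rewrite divr_gt0.
  apply: filterS (H n.+1 (leqnn _) _ e20) => eps; rewrite xn.
  rewrite (_ : M * w * (b - a) = e / 2) -?splitr//.
  by rewrite mulrAC /w mulrC divfK// mulf_neq0// gt_eqF.
elim: i => [_ eta eta0|i IH iSn eta eta0].
  near=> eps; rewrite x0 set_itvoo0 Rintegral_set0 normr0 subrr mulr0 add0r; exact: ltW.
have eta20 : 0 < eta / 2 by rewrite divr_gt0.
have IH' := IH (ltnW iSn) _ eta20.
have hx0 : 0 < `|h (x_ i)| + 1 by rewrite ltr_wpDl.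
have hx1 : 0 < eta / 2 / (`|h (x_ i)| + 1) by rewrite divr_gt0.
have /cvgr0Pnorm_le/(_ _ hx1) small := fam0 (xS i).
near=> eps.
have eps0 : 0 < eps by [].
have bhi x y := family_integrableM eps0 (measurable_itv `]x, y[) (hi x y).
have ax : a <= x_ i by rewrite -x0; exact: x_le.
rewrite (Rintegral_split ax (ltW (xS i)) (bhi _ _)).
rewrite (_ : M * w * (x_ i.+1 - a) + eta =
  (M * w * (x_ i - a) + eta / 2) + (M * w * (x_ i.+1 - x_ i) + eta / 2)); last first.
  by field.
apply: le_trans (ler_normD _ _) _; apply: lerD; first by near: eps; exact: IH'.
have ci : mu.-integrable `]x_ i, x_ i.+1[ (EFin \o (cst (h (x_ i)))).
  by apply: continuous_integrable_oo; exact: cst_continuous.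
have hci : mu.-integrable `]x_ i, x_ i.+1[ (EFin \o (fun t => -1 * h (x_ i) + h t)).
  exact: (integrableZD _ (-1) ci).
rewrite (_ : Rintegral _ _ _ = \int[mu]_(t in `]x_ i, x_ i.+1[) (fam eps t * (-1 * h (x_ i) + h t)) +
    h (x_ i) * \int[mu]_(t in `]x_ i, x_ i.+1[) fam eps t); last first.
  have bi : mu.-integrable `]x_ i, x_ i.+1[ (EFin \o fam eps).
    have c1 : mu.-integrable `]x_ i, x_ i.+1[ (EFin \o (cst 1)).
      by apply: continuous_integrable_oo; exact: cst_continuous.
    apply: eq_integrable (family_integrableM eps0 (measurable_itv _) c1) => // t _.
    by rewrite /= mulr1.
  rewrite -RintegralZl// -RintegralD//.
  - by apply: eq_Rintegral => t _; ring.
  - exact: (family_integrableM eps0 (measurable_itv _) hci).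
  - exact: integrable_scale.
apply: le_trans (ler_normD _ _) _; apply: lerD; last first.
  rewrite normrM.
  have : `|\int[mu]_(t in `]x_ i, x_ i.+1[) fam eps t| <= eta / 2 / (`|h (x_ i)| + 1).
    by near: eps; exact: small.
  rewrite ler_pdivlMr// => /(le_trans _); apply.
  by rewrite mulrC ler_wpM2l// lerDl.
apply: le_trans (family_integral_le eps0 (measurable_itv _) hci) _.
rewrite -mulrA ler_pM2l// -(Rintegral_cst_itv (xS i)).
apply: le_Rintegral => //.
- exact: (integrable_norm hci).
- by apply: continuous_integrable_oo; exact: cst_continuous.
- move=> t /=; rewrite in_itv/= => /andP[t1 t2].
  rewrite mulN1r addrC distrC; apply: hd.
    by rewrite /= in_itv/= ax -xn x_le// ltnW.
  rewrite distrC gtr0_norm ?subr_gt0//; apply: lt_trans nd.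
  by rewrite -(xSB i) ltrD2r.
Unshelve. all: by end_near. Qed.

(** Continuous functions are dense in L^1, and the bound M makes the pairing with
the family continuous in L^1, uniformly in the parameter. *)
Lemma family_cvg_integrable g : mu.-integrable D (EFin \o g) ->
  \int[mu]_(t in D) (fam eps t * g t) @[eps --> 0^'+] --> 0.
Proof.
move=> gi; apply/cvgr0Pnorm_le => e e0.
have muD : (mu D < +oo)%E by rewrite lebesgue_measure_itv/= lte_fin ab ltry.
have [g_ [cg ig /fine_cvgP[_ g0]]] := approximation_continuous_integrable mD muD gi.
have e2M : 0 < e / 2 / M by rewrite !divr_gt0.
have e20 : 0 < e / 2 by rewrite divr_gt0.
have /cvgr0Pnorm_le/(_ _ e2M)[n _ /(_ n (leqnn n))] := g0.
rewrite /= => gn.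
have /cvgr0Pnorm_le/(_ _ e20) bn := family_cvg_continuous (cg n).
near=> eps.
have eps0 : 0 < eps by [].
have dgi : mu.-integrable D (EFin \o (fun t => -1 * g_ n t + g t)).
  by apply: integrableZD.
rewrite (_ : Rintegral _ _ _ = \int[mu]_(t in D) (fam eps t * (-1 * g_ n t + g t)) +
    \int[mu]_(t in D) (fam eps t * g_ n t)); last first.
  rewrite -RintegralD//; [|exact: family_integrableM..].
  by apply: eq_Rintegral => t _; ring.
rewrite [leRHS]splitr; apply: le_trans (ler_normD _ _) _; apply: lerD; last first.
  by near: eps; exact: bn.
apply: le_trans (family_integral_le eps0 mD dgi) _.
rewrite mulrC -ler_pdivlMr//; apply: le_trans gn.
rewrite ger0_norm; last by apply: fine_ge0; apply: integral_ge0.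
rewrite /Rintegral le_eqVlt; apply/orP; left; apply/eqP; congr fine.
by apply: eq_integral => t _; rewrite mulN1r addrC.
Unshelve. all: by end_near. Qed.

End WeakStar.

(** * Homogenization from the mean of the reciprocal *)

Lemma near_cvg (R : realType) (f g : R -> R) (x l : R) :
  (\forall e \near x^'+, f e = g e) -> g e @[e --> x^'+] --> l -> f e @[e --> x^'+] --> l.
Proof.
by move=> fg; apply: cvg_trans; apply: near_eq_cvg; apply: filterS fg => e ->.
Qed.

Section Deterministic.
Context {R : realType}.
Local Notation mu := (@lebesgue_measure R).
Local Notation mR := (measurableTypeR R).
Variables (A b : R -> R) (m k1 k2 : R).
Hypothesis k1_gt0 : 0 < k1.
Hypothesis bk : forall x, k1 <= b x <= k2.
Hypothesis m0 : 0 < m.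
Hypothesis mA : measurable_fun [set: mR] A.
Hypothesis mb : measurable_fun [set: mR] b.
Hypothesis Ab : {ae mu, forall x, A x = (b x)^-1}.
Hypothesis bpos : r^-1 * \int[mu]_(t in `]0, r[) b t @[r --> +oo] --> m.
Hypothesis bneg : r^-1 * \int[mu]_(t in `](- r), 0[) b t @[r --> +oo] --> m.

Lemma b_gt0 x : 0 < b x.
Proof. by have /andP[+ _] := bk x; exact: lt_le_trans. Qed.

Lemma k2_gt0 : 0 < k2.
Proof. by have /andP[_] := bk 0; apply: lt_le_trans; exact: b_gt0. Qed.

Lemma measurable_dilation (f : R -> R) (eps : R) : measurable_fun [set: mR] f ->
  measurable_fun [set: mR] (fun x => f (eps^-1 * x)).
Proof.
by move=> mf; apply: (measurableT_comp (f := f)) => //; exact: measurable_funM.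
Qed.

Lemma Rintegral_dilation (eps x y : R) : 0 < eps ->
  \int[mu]_(t in `]x, y[) b (eps^-1 * t) =
  eps * \int[mu]_(t in `]eps^-1 * x, eps^-1 * y[) b t.
Proof.
move=> e0; have := @Rintegral_affine _ eps^-1 0 b x y _ mb (fun t => ltW (b_gt0 t)).
rewrite invr_gt0 invrK !addr0 => <- //.
by apply: eq_Rintegral => t _; rewrite addr0.
Qed.

Lemma cvg_divr_pinfty (x : R) : 0 < x -> eps^-1 * x @[eps --> 0^'+] --> +oo.
Proof.
move=> x0; apply/cvgryPge => B; near=> eps.
have e0 : 0 < eps by [].
rewrite ler_pdivlMl// mulrC; apply: (@le_trans _ _ ((`|B| + 1) * eps)).
  by rewrite ler_pM2r// (le_trans (ler_norm _))// lerDl.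
rewrite mulrC -ler_pdivlMr ?ltr_wpDl//; near: eps; apply: nbhs_right_le.
by rewrite divr_gt0// ltr_wpDl.
Unshelve. all: by end_near. Qed.

(** Rescaled, the integral over ]0, x[ is x times an average of b over
]0, x / eps[. *)
Lemma mean_dilation_pos (x : R) : 0 < x ->
  \int[mu]_(t in `]0, x[) b (eps^-1 * t) @[eps --> 0^'+] --> x * m.
Proof.
move=> x0.
have H := cvg_comp _ _ (cvg_divr_pinfty x0) bpos.
apply: near_cvg; last exact: (cvgM (cvg_cst x) H).
near=> eps.
have e0 : 0 < eps by [].
rewrite Rintegral_dilation// mulr0 /= mulrA; congr (_ * _).
by field; rewrite !gt_eqF.
Unshelve. all: by end_near. Qed.

Lemma mean_dilation_neg (x : R) : x < 0 ->
  \int[mu]_(t in `]x, 0[) b (eps^-1 * t) @[eps --> 0^'+] --> - x * m.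
Proof.
move=> x0; have nx0 : 0 < - x by rewrite oppr_gt0.
have H := cvg_comp _ _ (cvg_divr_pinfty nx0) bneg.
apply: near_cvg; last exact: (cvgM (cvg_cst (- x)) H).
near=> eps.
have e0 : 0 < eps by [].
rewrite Rintegral_dilation// mulr0 /= mulrN opprK mulrA; congr (_ * _).
by field; rewrite gt_eqF// lt_eqF.
Unshelve. all: by end_near. Qed.

Lemma integrable_dilation (eps x y : R) : mu.-integrable `]x, y[ (EFin \o (fun t => b (eps^-1 * t))).
Proof.
have c1 : mu.-integrable `]x, y[ (EFin \o (cst 1)).
  by apply: continuous_integrable_oo; exact: cst_continuous.
have mbe := measurable_dilation eps mb.
have mI : @measurable _ mR `]x, y[%classic by exact: measurable_itv.
have bb : {ae mu, forall t, `]x, y[%classic t -> `|b (eps^-1 * t)| <= k2}.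
  apply: aeW => t _; have /andP[_] := bk (eps^-1 * t).
  by rewrite gtr0_norm// b_gt0.
have mbI : measurable_fun `]x, y[ (fun t : mR => b (eps^-1 * t)).
  exact: measurable_funTS.
have := integrable_bddM mI mbI bb c1.
by apply: eq_integrable => // t _ /=; rewrite mulr1.
Qed.

(** Averages start at 0, so the interval is obtained from the intervals joining 0
to its end points: by subtraction, or by addition if it contains 0. *)
Lemma mean_dilation_itv (x y : R) : x < y ->
  \int[mu]_(t in `]x, y[) b (eps^-1 * t) @[eps --> 0^'+] --> (y - x) * m.
Proof.
move=> xy; have ib e := integrable_dilation e x y.
have [y0|y0|y0] := ltgtP 0 y; last first.
- by subst y; rewrite sub0r; exact: mean_dilation_neg.
- have x0 := lt_trans xy y0.
  rewrite (_ : (y - x) * m = - x * m - - y * m); last by ring.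
  apply: near_cvg; last exact: (cvgB (mean_dilation_neg x0) (mean_dilation_neg y0)).
  near=> eps.
  rewrite /= (@Rintegral_split _ _ x y 0) ?ltW ?addrK//.
  exact: integrable_dilation.
have [x0|x0|x0] := ltgtP 0 x; last first.
- by subst x; rewrite subr0; exact: mean_dilation_pos.
- rewrite (_ : (y - x) * m = - x * m + y * m); last by ring.
  apply: near_cvg; last exact: (cvgD (mean_dilation_neg x0) (mean_dilation_pos y0)).
  near=> eps.
  rewrite /= (@Rintegral_split _ _ x 0 y) ?ltW//.
- rewrite mulrBl; apply: near_cvg; last exact: (cvgB (mean_dilation_pos y0) (mean_dilation_pos x0)).
  near=> eps.
  rewrite /= (@Rintegral_split _ _ 0 x y) ?ltW ?integrable_dilation//.
  by rewrite addrC addKr.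
Unshelve. all: by end_near. Qed.

Definition fluctuation (eps x : R) : R := b (eps^-1 * x) - m.

Lemma measurable_fluctuation eps : measurable_fun [set: mR] (fluctuation eps).
Proof. by apply: measurable_funB => //; exact: measurable_dilation. Qed.

Lemma fluctuation_le eps x : `|fluctuation eps x| <= k2 + m.
Proof.
apply: le_trans (ler_normB _ _) _; rewrite !gtr0_norm ?b_gt0// lerD2r.
by have /andP[] := bk (eps^-1 * x).
Qed.

Lemma fluctuation_cvg0 (al bt : R) (g : R -> R) : al < bt -> mu.-integrable `]al, bt[ (EFin \o g) ->
  \int[mu]_(t in `]al, bt[) (fluctuation eps t * g t) @[eps --> 0^'+] --> 0.
Proof.
move=> ab; apply: (@family_cvg_integrable _ _ _ ab fluctuation (k2 + m)).
- by rewrite addr_gt0// k2_gt0.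
- by move=> eps _; exact: measurable_fluctuation.
- by move=> eps _; apply: aeW => x; exact: fluctuation_le.
- move=> x y xy.
  rewrite -[X in _ --> X](subrr ((y - x) * m)).
  apply: near_cvg; last exact: (cvgB (mean_dilation_itv xy) (cvg_cst ((y - x) * m))).
  near=> eps.
  rewrite /= RintegralB//; last 2 first.
  - exact: integrable_dilation.
  - by apply: continuous_integrable_oo; exact: cst_continuous.
  by rewrite (Rintegral_cst_itv xy) [m * _]mulrC.
Unshelve. all: by end_near. Qed.

Lemma ae_dilation (eps : R) : 0 < eps ->
  {ae mu, forall x, A (eps^-1 * x) = (b (eps^-1 * x))^-1}.
Proof.
move=> e0; have e1 : 0 < eps^-1 by rewrite invr_gt0.
by apply: aeS (ae_affine 0 e1 Ab) => x; rewrite addr0.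
Qed.

Lemma elliptic_of_reciprocal : elliptic A.
Proof.
split=> //; exists k2^-1, (k1^-1 + 1); split.
- by rewrite invr_gt0 k2_gt0.
- have : k2^-1 <= k1^-1.
    by rewrite lef_pV2 ?posrE ?k2_gt0//; have /andP[+ +] := bk 0; exact: le_trans.
  by move=> /le_lt_trans; apply; rewrite ltrDl.
- apply: aeS Ab => x -> xi; rewrite real_normK ?num_real//.
  rewrite (_ : xi * _ = (b x)^-1 * xi ^+ 2); last by ring.
  have /andP[b1 b2] := bk x.
  rewrite !ler_wpM2r ?sqr_ge0//.
    by rewrite (@le_trans _ _ k1^-1) ?lerDl// lef_pV2 ?posrE ?b_gt0.
  by rewrite lef_pV2 ?posrE ?k2_gt0 ?b_gt0.
Qed.

Section Problem.
Variables (al bt : R).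
Hypothesis ab : al < bt.
Local Notation D := (`]al, bt[%classic : set R).
Local Notation wd := (weak_derivative D).
Variables (f : (R -> R) -> R) (u : R -> R -> R) (u0 : R -> R).
Hypothesis hu : forall eps, 0 < eps -> weak_solution D (fun x => A (eps^-1 * x)) f (u eps).
Hypothesis hu0 : weak_solution D (cst m^-1) f u0.

Let mD : @measurable _ (measurableTypeR R) D. Proof. exact: measurable_itv. Qed.

Lemma u0_H1 : H1 D u0. Proof. by case: hu0 => /H10_H1. Qed.
Lemma u_H1 eps : 0 < eps -> H1 D (u eps). Proof. by move=> /hu[/H10_H1]. Qed.

Lemma L2_conductivity eps g : 0 < eps -> L2 D g -> L2 D (fun x => A (eps^-1 * x) * g x).
Proof.
move=> e0; apply: (L2_bddM mD (M := k1^-1)).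
  by apply: measurable_funTS; exact: measurable_dilation.
apply: aeS (ae_dilation e0) => x -> _.
rewrite gtr0_norm ?invr_gt0 ?b_gt0// lef_pV2 ?posrE ?b_gt0//.
by have /andP[] := bk (eps^-1 * x).
Qed.

Lemma L2_resistance eps g : L2 D g -> L2 D (fun x => b (eps^-1 * x) * g x).
Proof.
apply: (L2_bddM mD (M := k2)).
  by apply: measurable_funTS; exact: measurable_dilation.
apply: aeW => x _; rewrite gtr0_norm ?b_gt0//.
by have /andP[] := bk (eps^-1 * x).
Qed.

(** Both fluxes satisfy the same weak equation, so their difference is orthogonal
to the derivatives of all test functions. *)
Lemma flux_constant eps : 0 < eps -> exists c, {ae mu, forall x, D x ->
  A (eps^-1 * x) * wd (u eps) x = m^-1 * wd u0 x + c}.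
Proof.
move=> e0; have [hue ueE] := hu e0; have [hue0 u0E] := hu0.
have UL := L2_wd (u_H1 e0); have U0L := L2_wd u0_H1.
have AUL := L2_conductivity e0 UL.
(* The difference of the two fluxes. *)
pose h x := - m^-1 * wd u0 x + A (eps^-1 * x) * wd (u eps) x.
have hL : L2 D h by exact: L2_ZD.
have [|c hc] := du_bois_reymond (L2_integrable hL).
  move=> phi tphi; have tphiH := H10_test ab tphi.
  have WL := L2_wd (H10_H1 tphiH).
  rewrite (ae_eq_Rintegral mD (g := fun x => - m^-1 * (wd u0 x * wd phi x) +
      A (eps^-1 * x) * wd (u eps) x * wd phi x)); last 3 first.
  - apply: measurable_funM; last exact: L2_measurable hL.
    by apply: L2_measurable => //; exact/L2_test/test_function_derive1.
  - apply: measurable_funD; last by apply: measurable_funM; exact: L2_measurable.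
    by apply: measurable_funM => //; apply: measurable_funM; exact: L2_measurable.
  - apply: aeS (wd_test ab tphi) => x E Dx; rewrite E// /h.
    by move: (derive1 _ _) => p; ring.
  rewrite RintegralZD//; [|exact: (L2_integrableM mD)..].
  rewrite ueE// -u0E// -RintegralZl//; last exact: (L2_integrableM mD).
  rewrite -RintegralD//.
  - under eq_Rintegral => x _ do rewrite /= mulNr mulrA addNr.
    by rewrite Rintegral_cst// mul0r.
  - by apply: integrable_scale => //; exact: (L2_integrableM mD).
  - have := integrable_scale mD m^-1 (L2_integrableM mD U0L WL).
    by apply: eq_integrable => // x _ /=; rewrite mulrA.
exists c; apply: aeS hc => x hx Dx; rewrite -(hx Dx) /h.
by rewrite mulNr addrA subrr add0r.
Qed.

(** The weak derivatives of [u eps] and u0 both have mean zero.  Dividing the flux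
identity by A and integrating thus determines c, and only the fluctuation of b
remains paired with the derivative of u0. *)
Lemma flux_constant_le : exists K, 0 < K /\ forall eps, 0 < eps -> exists c,
  {ae mu, forall x, D x -> A (eps^-1 * x) * wd (u eps) x = m^-1 * wd u0 x + c} /\
  `|c| <= K * `|\int[mu]_(x in D) (fluctuation eps x * wd u0 x)|.
Proof.
have ba0 : 0 < bt - al by rewrite subr_gt0.
exists (m^-1 / (k1 * (bt - al))); split.
  by rewrite divr_gt0 ?invr_gt0// mulr_gt0.
move=> eps e0; have [c hc] := flux_constant e0; exists c; split => //.
have [hue _] := hu e0; have [hue0 _] := hu0.
have UL := L2_wd (u_H1 e0); have U0L := L2_wd u0_H1.
have bUL := L2_resistance eps U0L.
have ib := integrable_dilation eps al bt.
have E : 0 = m^-1 * \int[mu]_(x in D) (b (eps^-1 * x) * wd u0 x) +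
    c * \int[mu]_(x in D) b (eps^-1 * x).
  rewrite -(integral_wd_eq0 ab hue) -[X in _ = _ + X]RintegralZl// -RintegralZD//; last 2 first.
  - exact: L2_integrable.
  - exact: integrable_scale.
  apply: ae_eq_Rintegral => //.
  - exact: L2_measurable UL.
  - apply: measurable_funD; apply: measurable_funM => //.
      exact: L2_measurable bUL.
    by apply: measurable_funTS; exact: measurable_dilation.
  - apply: aeS2 (ae_dilation e0) hc => x AE H Dx; have := H Dx; rewrite AE.
    move=> /(congr1 (fun y => b (eps^-1 * x) * y)).
    rewrite mulrA divff ?mul1r; last by rewrite gt_eqF// b_gt0.
    by move=> ->; ring.
have fl : \int[mu]_(x in D) (fluctuation eps x * wd u0 x) =
    \int[mu]_(x in D) (b (eps^-1 * x) * wd u0 x).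
  under eq_Rintegral => x _ do rewrite /fluctuation mulrBl.
  rewrite RintegralB//; [|exact: L2_integrable|]; last first.
    by apply: integrable_scale => //; exact: L2_integrable.
  rewrite RintegralZl//; last exact: L2_integrable.
  by rewrite (integral_wd_eq0 ab hue0) mulr0 subr0.
rewrite fl; move: E; set I := Rintegral _ _ _; set B := Rintegral _ _ _ => E.
have B1 : k1 * (bt - al) <= B.
  rewrite -(Rintegral_cst_itv ab) /B; apply: le_Rintegral => //.
    by apply: continuous_integrable_oo; exact: cst_continuous.
  by move=> x _; have /andP[] := bk (eps^-1 * x).
have kb0 : 0 < k1 * (bt - al) by rewrite mulr_gt0.
rewrite mulrAC ler_pdivlMr//.
apply: (@le_trans _ _ (`|c| * B)); first by rewrite ler_wpM2l.
have -> : `|c| * B = `|m^-1 * I|.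
  rewrite -[B]gtr0_norm ?(lt_le_trans kb0)// -normrM.
  by rewrite (_ : c * B = - (m^-1 * I)) ?normrN//; apply/eqP; rewrite -addr_eq0 addrC -E.
by rewrite normrM gtr0_norm ?invr_gt0.
Qed.

Lemma flux_small e : 0 < e -> \forall eps \near 0^'+, exists c,
  {ae mu, forall x, D x -> A (eps^-1 * x) * wd (u eps) x = m^-1 * wd u0 x + c} /\
  `|c| <= e.
Proof.
move=> e0; have [K [K0 HK]] := flux_constant_le.
have U0L := L2_wd u0_H1.
have eK : 0 < e / K by rewrite divr_gt0.
have /cvgr0Pnorm_le/(_ _ eK) fl := fluctuation_cvg0 ab (L2_integrable U0L).
near=> eps.
have e1 : 0 < eps by [].
have [c [hc cK]] := HK _ e1; exists c; split => //.
apply: (le_trans cK); rewrite mulrC -ler_pdivlMr//; near: eps; exact: fl.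
Unshelve. all: by end_near. Qed.

(** The fluxes converge in norm, as they differ by a constant that tends to 0. *)
Lemma flux_cvg : weak_cvg_L2 D
  (fun eps x => A (eps^-1 * x) * wd (u eps) x) (fun x => m^-1 * wd u0 x).
Proof.
move=> g gL; apply/cvgrPdist_le => e e0.
have gi := L2_integrable gL.
have U0L := L2_wd u0_H1.
set I := \int[mu]_(x in D) g x.
have I0 : 0 < `|I| + 1 by rewrite ltr_wpDl.
have eI : 0 < e / (`|I| + 1) by rewrite divr_gt0.
near=> eps.
have e1 : 0 < eps by [].
have [c [hc ce]] : exists c, {ae mu, forall x, D x ->
    A (eps^-1 * x) * wd (u eps) x = m^-1 * wd u0 x + c} /\ `|c| <= e / (`|I| + 1).
  by near: eps; exact: flux_small.
have UL := L2_wd (u_H1 e1).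
have AUL := L2_conductivity e1 UL.
rewrite (ae_eq_Rintegral mD (f := fun x => A (eps^-1 * x) * wd (u eps) x * g x)
  (g := fun x => c * g x + m^-1 * wd u0 x * g x)); last 3 first.
- by apply: measurable_funM; [exact: L2_measurable AUL|exact: L2_measurable gL].
- apply: measurable_funD; first by apply: measurable_funM => //; exact: L2_measurable gL.
  apply: measurable_funM; last exact: L2_measurable gL.
  by apply: measurable_funM => //; exact: L2_measurable U0L.
- by apply: aeS hc => x H Dx; rewrite H//; ring.
have mUg : mu.-integrable D (EFin \o (fun x => m^-1 * wd u0 x * g x)).
  have := integrable_scale mD m^-1 (L2_integrableM mD U0L gL).
  by apply: eq_integrable => // x _ /=; rewrite mulrA.
rewrite RintegralZD// opprD addrCA subrr addr0 normrN normrM.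
apply: (@le_trans _ _ (e / (`|I| + 1) * (`|I| + 1))).
  by rewrite ler_pM// lerDl.
by rewrite divfK// gt_eqF.
Unshelve. all: by end_near. Qed.

Let w eps x : R := -1 * u0 x + u eps x.

Lemma remainder_H10 eps : 0 < eps -> H10 D (w eps).
Proof.
by move=> e0; apply: H10_ZD => //; [case: hu0|case: (hu e0)].
Qed.

Lemma wd_remainder eps c : 0 < eps ->
  {ae mu, forall x, D x -> A (eps^-1 * x) * wd (u eps) x = m^-1 * wd u0 x + c} ->
  {ae mu, forall x, D x -> wd (w eps) x =
     m^-1 * (fluctuation eps x * wd u0 x) + c * b (eps^-1 * x)}.
Proof.
move=> e0 hc.
have wE0 : {ae mu, forall x, D x -> wd (w eps) x = -1 * wd u0 x + wd (u eps) x}.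
  exact: (wd_ZD ab (-1) u0_H1 (u_H1 e0)).
apply: aeS3 wE0 (ae_dilation e0) hc.
move=> x wE AE H Dx; rewrite wE//.
have := H Dx; rewrite AE => /(congr1 (fun y => b (eps^-1 * x) * y)).
rewrite mulrA divff ?mul1r; last by rewrite gt_eqF// b_gt0.
by move=> ->; rewrite /fluctuation; field; rewrite gt_eqF.
Qed.

Lemma measurable_resistance eps : measurable_fun D (fun x : mR => b (eps^-1 * x)).
Proof. by apply: measurable_funTS; exact: measurable_dilation. Qed.

Lemma L2_resistance1 eps : L2 D (fun x => b (eps^-1 * x)).
Proof.
have := L2_resistance eps (L2_cst al bt 1); congr (L2 _ _).
by apply/funext => x; rewrite mulr1.
Qed.

Lemma L2_fluctuation eps g : L2 D g -> L2 D (fun x => fluctuation eps x * g x).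
Proof.
apply: (L2_bddM mD (M := k2 + m)).
  by apply: measurable_funTS; exact: measurable_fluctuation.
by apply: aeW => x _; exact: fluctuation_le.
Qed.

(** A bound on the energy is what the error term of [approx_riesz] requires. *)
Lemma energy_remainder_bounded : exists Q, 0 < Q /\
  \forall eps \near 0^'+, energy al bt (w eps) <= Q.
Proof.
have U0L := L2_wd u0_H1.
set q := \int[mu]_(x in D) (wd u0 x ^+ 2).
have q0 : 0 <= q by exact: sqr_integral_ge0.
have ba0 : 0 < bt - al by rewrite subr_gt0.
exists (2 * (m^-1 ^+ 2 * ((k2 + m) ^+ 2 * q) + k2 ^+ 2 * (bt - al))); split.
  apply: mulr_gt0 => //; apply: ltr_wpDl.
    by apply: mulr_ge0; [exact: sqr_ge0|apply: mulr_ge0 => //; exact: sqr_ge0].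
  by rewrite mulr_gt0// exprn_gt0// k2_gt0.
near=> eps.
have e1 : 0 < eps by [].
have [c [hc c1]] : exists c, {ae mu, forall x, D x ->
    A (eps^-1 * x) * wd (u eps) x = m^-1 * wd u0 x + c} /\ `|c| <= 1.
  by near: eps; exact: flux_small.
have FL := L2_fluctuation eps U0L.
have BL : L2 D (fun x => c * b (eps^-1 * x)).
  have := L2_ZD mD c (L2_resistance1 eps) (L2_cst al bt 0); congr (L2 _ _).
  by apply/funext => x; rewrite addr0.
have WL := L2_wd (H10_H1 (remainder_H10 e1)).
rewrite /energy (ae_sqr_integral _ _ (wd_remainder e1 hc)); last 2 first.
- exact: L2_measurable WL.
- by apply: L2_measurable => //; exact: L2_ZD.
apply: le_trans (sqr_integralD_le _ FL BL) _.
rewrite ler_pM2l//; apply: lerD.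
  rewrite ler_wpM2l ?sqr_ge0// -RintegralZl//; last exact: L2_integrable_sqr.
  apply: le_Rintegral => //.
  - exact: L2_integrable_sqr.
  - by apply: integrable_scale => //; exact: L2_integrable_sqr.
  - move=> x _; rewrite exprMn ler_wpM2r ?sqr_ge0//.
    rewrite -real_normK ?num_real// lerXn2r ?nnegrE ?fluctuation_le//.
    by rewrite addr_ge0 ?ltW ?k2_gt0.
rewrite -(Rintegral_cst_itv ab); apply: le_Rintegral => //.
- exact: L2_integrable_sqr.
- by apply: continuous_integrable_oo; exact: cst_continuous.
- move=> x _; rewrite exprMn -[leRHS]mul1r.
  apply: ler_pM; rewrite ?sqr_ge0//.
    by rewrite -real_normK ?num_real// -[leRHS](expr1n _ 2) lerXn2r ?nnegrE.
  rewrite lerXn2r ?nnegrE ?(ltW (b_gt0 _)) ?(ltW k2_gt0)//.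
  by have /andP[] := bk (eps^-1 * x).
Unshelve. all: by end_near. Qed.

Lemma wd_remainder_cvg0 (V : R -> R) : L2 D V ->
  \int[mu]_(x in D) (wd (w eps) x * V x) @[eps --> 0^'+] --> 0.
Proof.
move=> VL; apply/cvgr0Pnorm_le => e e0.
have U0L := L2_wd u0_H1.
have UVi := L2_integrableM mD U0L VL.
have Vi := L2_integrable VL.
set I := k2 * \int[mu]_(x in D) `|V x|.
have I0 : 0 <= I.
  by rewrite mulr_ge0 ?(ltW k2_gt0)//; apply: Rintegral_ge0.
have eI : 0 < e / 2 / (I + 1) by rewrite !divr_gt0// ltr_wpDl.
have em : 0 < e / 2 * m by rewrite mulr_gt0// divr_gt0.
have /cvgr0Pnorm_le/(_ _ em) fl := fluctuation_cvg0 ab UVi.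
near=> eps.
have e1 : 0 < eps by [].
have [c [hc c1]] : exists c, {ae mu, forall x, D x ->
    A (eps^-1 * x) * wd (u eps) x = m^-1 * wd u0 x + c} /\ `|c| <= e / 2 / (I + 1).
  by near: eps; exact: flux_small.
have WL := L2_wd (H10_H1 (remainder_H10 e1)).
have FUVi : mu.-integrable D (EFin \o (fun x => fluctuation eps x * (wd u0 x * V x))).
  have := L2_integrableM mD (L2_fluctuation eps U0L) VL.
  by apply: eq_integrable => // x _ /=; rewrite mulrA.
have bVi := L2_integrableM mD (L2_resistance1 eps) VL.
rewrite (ae_eq_Rintegral mD (g := fun x => m^-1 * (fluctuation eps x * (wd u0 x * V x)) +
    c * (b (eps^-1 * x) * V x))); last 3 first.
- by apply: measurable_funM; [exact: L2_measurable WL|exact: L2_measurable VL].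
- apply: measurable_funD; apply: measurable_funM => //.
    exact: integrable_measurable FUVi.
  exact: integrable_measurable bVi.
- by apply: aeS (wd_remainder e1 hc) => x H Dx; rewrite H//; ring.
rewrite RintegralZD//; last exact: integrable_scale.
rewrite [in X in _ + X]RintegralZl// [leRHS]splitr.
apply: le_trans (ler_normD _ _) _; apply: lerD; rewrite normrM.
  rewrite gtr0_norm ?invr_gt0// ler_pdivrMl// mulrC.
  by near: eps; exact: fl.
apply: (@le_trans _ _ (e / 2 / (I + 1) * (I + 1))); last first.
  by rewrite divfK// gt_eqF// ltr_wpDl.
apply: ler_pM => //; apply: (@le_trans _ _ I); last by rewrite lerDl.
apply: Rintegral_bddM_le => //; first exact: measurable_resistance.
apply: aeW => x _; rewrite gtr0_norm ?b_gt0//.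
by have /andP[] := bk (eps^-1 * x).
Unshelve. all: by end_near. Qed.

(** By [approx_riesz] F is, up to an error controlled by the energy, the pairing
with a fixed derivative, for which [wd_remainder_cvg0] applies. *)
Lemma u_cvg : weak_cvg_H10 D u u0.
Proof.
move=> F HF; apply/cvgrPdist_le => e e0.
have [Q [Q0 HQ]] := energy_remainder_bounded.
have s0 : 0 < e / 2 / (Q + 1) by rewrite !divr_gt0// addr_gt0.
have e20 : 0 < e / 2 by rewrite divr_gt0.
have [v [hv Fv]] := approx_riesz ab HF s0.
have /cvgr0Pnorm_le/(_ _ e20) wv := wd_remainder_cvg0 (L2_wd (H10_H1 hv)).
near=> eps.
have e1 : 0 < eps by [].
have hw := remainder_H10 e1.
have Fw : F (w eps) = F (u eps) - F u0.
  have [hue _] := hu e1; have [hue0 _] := hu0.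
  by case: HF => + _ => /(_ (-1) _ _ hue0 hue) ->; rewrite mulN1r addrC.
rewrite distrC -Fw [leRHS]splitr.
rewrite -[F (w eps)](subrK (\int[mu]_(x in D) (wd (w eps) x * wd v x))).
apply: le_trans (ler_normD _ _) _; apply: lerD; last by near: eps; exact: wv.
apply: le_trans (Fv _ hw) _.
apply: (@le_trans _ _ (e / 2 / (Q + 1) * (Q + 1))).
  rewrite ler_pM2l// lerD2r; near: eps; exact: HQ.
by rewrite divfK// gt_eqF// addr_gt0.
Unshelve. all: by end_near. Qed.

End Problem.

(** The function b is 1/A corrected on a null set so as to be bounded everywhere;
in particular its dilations are nonnegative, as the change of variables
requires. *)
Theorem homogenization_of_mean : homogenized_coefficient A m^-1.
Proof.
split; [exact: elliptic_of_reciprocal|by rewrite invr_gt0|].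
move=> al bt ab D f _ u u0 hu hu0; split; first exact: u_cvg hu0.
exact: flux_cvg hu0.
Qed.

End Deterministic.

(** * The maximal ergodic inequality *)

Section MaximalErgodic.
Context {R : realType} d (Omega : measurableType d) (P : probability Omega R).
Variable tau : Omega -> Omega.
Hypothesis mtau : measurable_fun [set: Omega] tau.
Hypothesis tauP : forall F, measurable F -> P (tau @^-1` F) = P F.
Implicit Types (f phi : Omega -> R).

Let PT : (P [set: Omega] < +oo)%E. Proof. by rewrite probability_setT ltry. Qed.

Lemma bounded_integrable f (C : R) : measurable_fun [set: Omega] f ->
  (forall w, `|f w| <= C) -> P.-integrable [set: Omega] (EFin \o f).
Proof.
move=> mf fC; apply: measurable_bounded_integrable => //.
exists C; split; first exact: num_real.
by move=> x Cx w _ /=; apply: le_trans (fC w) _; exact: ltW.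
Qed.

Lemma ge0_integral_preserving (f : Omega -> R) : measurable_fun [set: Omega] f ->
  (forall w, 0 <= f w) ->
  (\int[P]_w (f (tau w))%:E = \int[P]_w (f w)%:E)%E.
Proof.
move=> mf f0.
have mEf : measurable_fun setT (EFin \o f) by exact/measurable_EFinP.
have := @ge0_integral_pushforward _ _ Omega Omega R tau mtau P setT (EFin \o f)
  measurableT mEf.
rewrite preimage_setT => <- //; last by move=> x _; rewrite lee_fin.
by apply: eq_measure_integral => A mA _; exact: tauP.
Qed.

(** The maximum of 0 and of the first n Birkhoff sums, written in the recursive
form from which the maximal inequality is read off. *)
Fixpoint max_sum phi (n : nat) (w : Omega) : R :=
  if n is n'.+1 then Num.max 0 (phi w + max_sum phi n' (tau w)) else 0.

Fixpoint birkhoff_sum phi (n : nat) (w : Omega) : R :=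
  if n is n'.+1 then phi w + birkhoff_sum phi n' (tau w) else 0.

Variable phi : Omega -> R.
Variable C : R.
Hypothesis mphi : measurable_fun [set: Omega] phi.
Hypothesis phiC : forall w, `|phi w| <= C.

Lemma max_sum_ge0 n w : 0 <= max_sum phi n w.
Proof. by case: n => //= n; rewrite le_max lexx. Qed.

Lemma max_sum_leS n w : max_sum phi n w <= max_sum phi n.+1 w.
Proof.
elim: n w => [|n IH] w; first exact: max_sum_ge0.
rewrite [leLHS]/= ge_max max_sum_ge0/= [leRHS]/= le_max; apply/orP; right.
by rewrite lerD2l IH.
Qed.

Lemma max_sum_homo w : {homo (fun n => max_sum phi n w) : m n / (m <= n)%N >-> m <= n}.
Proof. by apply: homo_leq => //; [exact: le_trans|move=> n; exact: max_sum_leS]. Qed.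

Lemma birkhoff_sum_le_max_sum n w : birkhoff_sum phi n w <= max_sum phi n w.
Proof.
elim: n w => [//|n IH] w; rewrite [leLHS]/= [leRHS]/= le_max.
by apply/orP; right; rewrite lerD2l IH.
Qed.

Lemma measurable_max_sum n : measurable_fun [set: Omega] (max_sum phi n).
Proof.
elim: n => [|n IH]; first exact: measurable_cst.
apply: measurable_maxr; first exact: measurable_cst.
by apply: measurable_funD => //; exact: measurableT_comp IH mtau.
Qed.

Lemma max_sum_le n w : max_sum phi n w <= C *+ n.
Proof.
elim: n w => [|n IH] w; first by rewrite mulr0n.
have C0 : 0 <= C by exact: le_trans (phiC w).
rewrite [leLHS]/= ge_max mulrn_wge0//= mulrS lerD//.
by apply: le_trans (phiC w); exact: ler_norm.
Qed.

(** Garsia's argument.  Let M be the maximum of the first n sums.  Where M is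
positive phi is at least M - M o tau by the recursion, elsewhere
M - M o tau is nonpositive; and its integral is 0 since tau preserves P. *)
Lemma maximal_ergodic n : 0 <= \int[P]_(w in [set w | 0 < max_sum phi n w]) phi w.
Proof.
set E := [set w | _].
have mE : measurable E.
  rewrite (_ : E = [set: Omega] `&` max_sum phi n @^-1` `]0, +oo[).
    exact: measurable_max_sum.
  by apply/seteqP; split => w /=; rewrite in_itv/= andbT => // -[].
have mMt : measurable_fun [set: Omega] (fun w => max_sum phi n (tau w)).
  exact: measurableT_comp (measurable_max_sum n) mtau.
have Mle w : `|max_sum phi n w| <= C *+ n by rewrite ger0_norm ?max_sum_ge0// max_sum_le.
have iM := bounded_integrable (measurable_max_sum n) Mle.
have iMt := bounded_integrable mMt (fun w => Mle (tau w)).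
have iphi := bounded_integrable mphi phiC.
have ME : \int[P]_w (max_sum phi n w - max_sum phi n (tau w)) = 0.
  rewrite RintegralB// /Rintegral.
  by rewrite (ge0_integral_preserving (measurable_max_sum n) (max_sum_ge0 n)) subrr.
rewrite Rintegral_mkcond -[leLHS]ME; apply: le_Rintegral => //.
- have := integrableB measurableT iM iMt.
  by apply: eq_integrable => // x _ /=.
- have iE : P.-integrable E (EFin \o phi) by apply: integrableS iphi.
  have := (@integrable_mkcond _ _ _ P E _ mE).1 iE.
  by rewrite restrict_EFin.
move=> w _; rewrite patchE; case: ifPn => [|/negP].
  rewrite inE /E/= => M0.
  case: n M0 {E mE mMt Mle iM iMt ME} => [|n]; first by rewrite /= ltxx.
  move=> M0; rewrite lerBlDr.
  apply: (@le_trans _ _ (phi w + max_sum phi n (tau w))); last first.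
    by rewrite lerD2l max_sum_leS.
  move: M0; rewrite /= lt_max ltxx/= => M0.
  by rewrite max_r// ltW.
rewrite inE /E/= => /negP; rewrite -leNgt => M0.
by rewrite (_ : max_sum phi n w = 0) ?sub0r ?oppr_le0 ?max_sum_ge0//; apply/le_anti; rewrite M0 max_sum_ge0.
Qed.

(** The sets on which [maximal_ergodic] integrates phi exhaust the space up to a
null set. *)
Lemma birkhoff_pos_integral_ge0 :
  {ae P, forall w, exists n, 0 < birkhoff_sum phi n w} -> 0 <= \int[P]_w phi w.
Proof.
move=> pos.
pose E n := [set w | 0 < max_sum phi n w].
have mE n : measurable (E n).
  rewrite (_ : E n = [set: Omega] `&` max_sum phi n @^-1` `]0, +oo[).
    exact: measurable_max_sum.
  by apply/seteqP; split => w /=; rewrite in_itv/= andbT => // -[].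
have iphi := bounded_integrable mphi phiC.
have mEphi : measurable_fun setT (EFin \o phi) by exact/measurable_EFinP.
pose fn n := (EFin \o phi) \_ (E n).
have mfn n : measurable_fun setT (fn n).
  by apply/(measurable_restrictT _ (mE n)); exact: measurable_funTS.
have fncv : {ae P, forall w, [set: Omega] w -> fn n w @[n --> \oo] --> (phi w)%:E}.
  apply: aeS pos => w [n wn] _; apply: cvg_near_cst.
  exists n => // k /= nk; rewrite /fn patchE mem_set// /E/=.
  apply: lt_le_trans wn _; apply: le_trans (birkhoff_sum_le_max_sum n w) _.
  exact: max_sum_homo.
have fnle : {ae P, forall w n, [set: Omega] w -> (`|fn n w| <= (abse \o (EFin \o phi)) w)%E}.
  apply: aeW => w n _; rewrite /fn patchE; case: ifPn => //= _.
  by rewrite lee_fin normr0 normr_ge0.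
have [_ _ cv] := dominated_convergence measurableT mfn mEphi fncv (integrable_abse iphi) fnle.
rewrite /Rintegral fine_ge0//.
apply: (cvge_ge _ cv).
near=> n; have := maximal_ergodic n; rewrite /Rintegral => H.
have iE : P.-integrable (E n) (EFin \o phi) by apply: integrableS iphi.
have := integrable_fin_num (mE n) iE => /fineK; rewrite integral_mkcond => E'.
by rewrite -[X in (_ <= X)%E]E' lee_fin -integral_mkcond.
Unshelve. all: by end_near. Qed.

End MaximalErgodic.

(** * Time averages along an ergodic flow *)

Section FlowAverages.
Context {R : realType} d (Omega : measurableType d) (P : probability Omega R).
Local Notation mu := (@lebesgue_measure R).
Local Notation mR := (measurableTypeR R).
Variable T : R -> Omega -> Omega.
Hypothesis hT : measure_preserving_system P T.
Variables (g : Omega -> R) (K : R).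
Hypothesis mg : measurable_fun [set: Omega] g.
Hypothesis g0 : forall w, 0 <= g w.
Hypothesis gK : forall w, g w <= K.

Lemma measurable_flow :
  measurable_fun [set: mR * Omega] (fun p : mR * Omega => g (T p.1 p.2)).
Proof. exact: (mps_joint hT mg). Qed.

Lemma measurable_orbit w : measurable_fun [set: mR] (fun s : mR => g (T s w)).
Proof. exact: (measurable_fun_pair1 w measurable_flow). Qed.

Lemma bound_ge0 : 0 <= K.
Proof.
suff [w] : [set: Omega] !=set0 by move=> _; exact: le_trans (gK w).
apply/set0P/negP => /eqP E; have := probability_setT P; rewrite E measure0.
by move=> /eqP; rewrite eq_sym onee_eq0.
Qed.

Lemma integrable_orbit w x y : mu.-integrable `]x, y[ (EFin \o (fun s => g (T s w))).
Proof.
have mI : @measurable _ mR `]x, y[%classic by exact: measurable_itv.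
have c1 : mu.-integrable `]x, y[ (EFin \o (cst K)).
  by apply: continuous_integrable_oo; exact: cst_continuous.
apply: (ae_le_integrable mI _ c1).
  by apply: measurable_funTS; exact: measurable_orbit.
by apply: aeW => s _; rewrite ger0_norm.
Qed.

Definition orbit_int (r : R) (w : Omega) : R := \int[mu]_(s in `]0, r[) g (T s w).

Lemma orbit_int_itv_ge0 w x y : 0 <= \int[mu]_(s in `]x, y[) g (T s w).
Proof. exact: Rintegral_ge0. Qed.

Lemma orbit_int_itv_le w x y : x <= y -> \int[mu]_(s in `]x, y[) g (T s w) <= K * (y - x).
Proof.
rewrite le_eqVlt => /predU1P[->|xy].
  by rewrite set_itvoo0 Rintegral_set0 subrr mulr0.
rewrite -(Rintegral_cst_itv xy); apply: le_Rintegral => //.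
- exact: integrable_orbit.
- by apply: continuous_integrable_oo; exact: cst_continuous.
Qed.

Lemma orbit_int_shift r x w :
  orbit_int r (T x w) = \int[mu]_(s in `]x, r + x[) g (T s w).
Proof.
have := @Rintegral_affine R 1 x (fun s => g (T s w)) 0 r ltr01 (measurable_orbit w)
  (fun s => g0 _).
rewrite invr1 !mul1r add0r => <-; apply: eq_Rintegral => s _.
by rewrite mul1r (mps_add hT).
Qed.

Lemma orbit_intS (n : nat) w : orbit_int n.+1%:R w = orbit_int 1 w + orbit_int n%:R (T 1 w).
Proof.
rewrite orbit_int_shift natr1 /orbit_int -(@Rintegral_split _ _ 0 1)//.
- by rewrite ler1n.
- exact: integrable_orbit.
Qed.

(** Moving the window of integration by x exchanges two end pieces of length x. *)
Lemma orbit_int_shift_le r x w : 0 <= x -> 0 <= r ->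
  `|orbit_int r (T x w) - orbit_int r w| <= K * x.
Proof.
move=> x0 r0; rewrite orbit_int_shift /orbit_int.
have E1 := @Rintegral_split _ _ 0 x (r + x) x0 _ (integrable_orbit w _ _).
have E2 := @Rintegral_split _ _ 0 r (r + x) r0 _ (integrable_orbit w _ _).
have := E1; rewrite E2 ?lerDr ?lerDl// => /(_ r0).
have := orbit_int_itv_ge0 w 0 x; have := orbit_int_itv_ge0 w r (r + x).
have := orbit_int_itv_le w x0; rewrite subr0.
have := @orbit_int_itv_le w r (r + x); rewrite lerDl addrAC subrr add0r => /(_ x0).
move: (\int[mu]_(s in `]r, r + x[) _) (\int[mu]_(s in `]0, x[) _)
  (\int[mu]_(s in `]0, r[) _) (\int[mu]_(s in `]x, r + x[) _) (K * x).
move=> a b c e k *; rewrite ler_norml; apply/andP; split; lra.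
Qed.

Lemma orbit_intE r w : orbit_int r w =
  fine (\int[mu]_s (\1_(`]0, r[%classic : set mR) s * g (T s w))%:E).
Proof.
rewrite /orbit_int Rintegral_mkcond; congr fine; apply: eq_integral => s _.
by rewrite patchE indicE; case: ifPn => _; rewrite ?mul1r ?mul0r.
Qed.

Lemma measurable_flow_indic r : measurable_fun [set: mR * Omega]
  (fun p : mR * Omega => (\1_(`]0, r[%classic : set mR) p.1 * g (T p.1 p.2))%:E).
Proof.
apply/measurable_EFinP; apply: measurable_funM; last exact: measurable_flow.
have m1 : measurable_fun [set: mR] (\1_(`]0, r[%classic : set mR) : mR -> R).
  by apply: measurable_indic; exact: measurable_itv.
exact: (measurableT_comp m1 measurable_fst).
Qed.

Let indic_ge0 r (p : mR * Omega) :
  (0 <= (\1_(`]0, r[%classic : set mR) p.1 * g (T p.1 p.2))%:E)%E.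
Proof. by rewrite lee_fin mulr_ge0. Qed.

Lemma measurable_orbit_int r : measurable_fun [set: Omega] (orbit_int r).
Proof.
rewrite (_ : orbit_int r = fine \o (fubini_G mu
    (fun p : mR * Omega => (\1_(`]0, r[%classic : set mR) p.1 * g (T p.1 p.2))%:E))).
  apply: measurableT_comp => //.
  apply: measurable_fun_fubini_tonelli_G; first exact: measurable_flow_indic.
  exact: indic_ge0.
by apply/funext => w; exact: orbit_intE.
Qed.

Lemma orbit_int_ge0 r w : 0 <= orbit_int r w.
Proof. exact: orbit_int_itv_ge0. Qed.

Lemma g_integrable : P.-integrable [set: Omega] (EFin \o g).
Proof. by apply: (@bounded_integrable _ _ _ _ _ K) => // w; rewrite ger0_norm. Qed.

(** Tonelli's theorem, each T s preserving P. *)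
Lemma expectation_orbit_int1 : \int[P]_w orbit_int 1 w = \int[P]_w g w.
Proof.
have gi := g_integrable.
rewrite /Rintegral; congr fine.
transitivity (\int[P]_w \int[mu]_s (\1_(`]0, 1[%classic : set mR) s * g (T s w))%:E)%E.
  apply: eq_integral => w _; rewrite orbit_intE fineK//.
  have := (@integrable_mkcond _ _ _ mu _ _ (measurable_itv `]0, 1[)).1 (integrable_orbit w 0 1).
  move/(integrable_fin_num measurableT); congr (_ \is a fin_num).
  apply: eq_integral => s _.
  by rewrite patchE indicE; case: ifPn => _; rewrite /= ?mul1r ?mul0r.
rewrite -(fubini_tonelli (m1 := mu) (m2 := P) _ (measurable_flow_indic 1) (indic_ge0 1)).
transitivity (\int[mu]_s ((\1_(`]0, 1[%classic : set mR) s)%:E * (\int[P]_w (g w)%:E)))%E.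
  apply: eq_integral => s _.
  under eq_integral do rewrite /= EFinM.
  rewrite ge0_integralZl//; last 2 first.
  - apply/measurable_EFinP; apply: measurableT_comp => //; exact: (mps_measurable hT).
  - by move=> w _; rewrite lee_fin.
  congr (_ * _)%E.
  exact: (ge0_integral_preserving (mps_measurable hT s) (mps_preserving hT s)).
rewrite ge0_integralZr//; last 2 first.
- by apply/measurable_EFinP; apply: measurable_indic; exact: measurable_itv.
- by apply: integral_ge0 => w _; rewrite lee_fin.
rewrite (@integral_indic _ _ _ mu setT measurableT _ (measurable_itv `]0, 1[)) setIT.
by rewrite /= lebesgue_measure_itv/= lte_fin ltr01 oppr0 adde0 mul1e.
Qed.

(** This makes the continuous-time averages at integer times Birkhoff averages of
the time-one map. *)
Lemma birkhoff_sum_orbit_int (c : R) n w :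
  birkhoff_sum (T 1) (fun w => orbit_int 1 w - c) n w = orbit_int n%:R w - c * n%:R.
Proof.
elim: n w => [|n IH] w /=.
  by rewrite mulr0 subr0 /orbit_int set_itvoo0 Rintegral_set0.
rewrite IH orbit_intS -natr1; ring.
Qed.

(** The margin 1/(k+1) makes this set invariant under the flow: along an orbit the
integral changes by a bounded amount, which a part of the margin absorbs when
n is large. *)
Definition exceed (c : R) : set Omega :=
  [set w | exists k, forall N, exists2 n, (N <= n)%N &
     (c + k.+1%:R^-1) * n%:R <= orbit_int n%:R w].

Lemma measurable_exceed c : measurable (exceed c).
Proof.
rewrite (_ : exceed c = \bigcup_k \bigcap_N \bigcup_(n in [set n | (N <= n)%N])
    [set w | (c + k.+1%:R^-1) * n%:R <= orbit_int n%:R w]).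
  apply: bigcupT_measurable => k; apply: bigcapT_measurable => N.
  apply: bigcup_measurable => n _.
  rewrite -[X in measurable X]setTI.
  rewrite (_ : [set w | _] = orbit_int n%:R @^-1` `[(c + k.+1%:R^-1) * n%:R, +oo[%classic).
    by apply: measurable_orbit_int => //; exact: measurable_itv.
  by apply/seteqP; split => w /=; rewrite in_itv/= andbT.
apply/seteqP; split => [w [k Hk]|w [k _ Hk]].
  by exists k => // N _; have [n Nn wn] := Hk N; exists n.
by exists k => N; have [n Nn wn] := Hk N I; exists n.
Qed.

(** Half of the margin absorbs the change K x of the integrals; the index k.*2.+1
stands for half of 1/(k+1). *)
Lemma exceed_shift c x w : 0 <= x -> exceed c w <-> exceed c (T x w).
Proof.
move=> x0.
suff H w1 w2 : (forall n : nat, `|orbit_int n%:R w1 - orbit_int n%:R w2| <= K * x) ->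
    exceed c w1 -> exceed c w2.
  split; apply: H => n; last exact: orbit_int_shift_le.
  by rewrite distrC; exact: orbit_int_shift_le.
move=> w12 [k Hk]; exists (k.*2.+1)%N => N.
(* From M on, half of the margin times n exceeds K x. *)
pose M := Num.bound (K * x * (k.+1.*2)%:R).
have [n Nn wn] := Hk (maxn N M).
move: Nn; rewrite geq_max => /andP[Nn Mn]; exists n => //.
have Kn : K * x * (k.+1.*2)%:R <= n%:R.
  apply/ltW; apply: (lt_le_trans (archi_boundP _)).
    by rewrite !mulr_ge0// bound_ge0.
  by rewrite ler_nat.
have := w12 n; rewrite ler_norml => /andP[_ wl].
have k2E : k.*2.+2 = k.+1.*2 by rewrite doubleS.
rewrite k2E; apply: (@le_trans _ _ ((c + k.+1%:R^-1) * n%:R - K * x)).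
  rewrite lerBrDr !mulrDl -addrA lerD2l.
  rewrite (_ : k.+1%:R^-1 = (k.+1.*2)%:R^-1 + (k.+1.*2)%:R^-1 :> R); last first.
    by rewrite -mul2n natrM; field; rewrite gt_eqF.
  by rewrite mulrDl lerD2l [leRHS]mulrC ler_pdivlMr.
by rewrite lerBlDr (le_trans wn)// -lerBlDl.
Qed.

Lemma exceed_invariant c : invariant_set T (exceed c).
Proof.
split; first exact: measurable_exceed.
move=> x; apply/seteqP; split => w /=.
  have [x0|x0] := leP 0 x; first by move/(exceed_shift c w x0).
  have nx0 : 0 <= - x by rewrite oppr_ge0 ltW.
  move/(exceed_shift c (T x w) nx0).
  by rewrite -[T (- x) (T x w)]/((T (- x) \o T x) w) -(mps_add hT) addNr (mps_id hT).
have [x0|x0] := leP 0 x; first by move/(exceed_shift c w x0).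
have nx0 : 0 <= - x by rewrite oppr_ge0 ltW.
move=> wE; apply/(exceed_shift c (T x w) nx0).
by rewrite -[T (- x) (T x w)]/((T (- x) \o T x) w) -(mps_add hT) addNr (mps_id hT).
Qed.

Hypothesis hTerg : ergodic P T.

(** Ergodicity of the flow leaves full measure as the only alternative.  Then
almost every point has a positive sum for [orbit_int 1 - c], and the maximal
inequality puts c below the mean. *)
Lemma exceed_null c : \int[P]_w g w < c -> P (exceed c) = 0%E.
Proof.
move=> gc; have [//|E1] := hTerg (exceed_invariant c).
exfalso; move: gc; apply/negP; rewrite -leNgt -subr_ge0.
have B1 w : `|orbit_int 1 w - c| <= K + `|c|.
  apply: le_trans (ler_normB _ _) _; rewrite lerD2r ger0_norm ?orbit_int_ge0//.
  by apply: le_trans (orbit_int_itv_le w ler01) _; rewrite subr0 mulr1.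
have mB : measurable_fun [set: Omega] (fun w => orbit_int 1 w - c).
  by apply: measurable_funB => //; exact: measurable_orbit_int.
suff : 0 <= \int[P]_w (orbit_int 1 w - c).
  rewrite RintegralB//; last 2 first.
  - apply: (@bounded_integrable _ _ _ _ _ K); first exact: measurable_orbit_int.
    move=> w; rewrite ger0_norm ?orbit_int_ge0//.
    by apply: le_trans (orbit_int_itv_le w ler01) _; rewrite subr0 mulr1.
  - exact: (@bounded_integrable _ _ _ _ _ `|c|).
  by rewrite expectation_orbit_int1 Rintegral_cst//= probability_setT mulr1.
apply: (birkhoff_pos_integral_ge0 (mps_measurable hT 1) (mps_preserving hT 1) mB B1).
exists (~` exceed c); split.
- by apply: measurableC; exact: measurable_exceed.
- by rewrite probability_setC ?E1 ?subee//; exact: measurable_exceed.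
move=> w /= wN wE; apply: wN; have [k /(_ 1%N)[n n1 wn]] := wE.
exists n; rewrite birkhoff_sum_orbit_int subr_gt0; apply: lt_le_trans wn.
by rewrite ltr_pM2r ?ltrDl ?invr_gt0// ltr0n.
Qed.

(** The levels c = mean + 1/(j+1) suffice, and there are countably many of them. *)
Lemma time_average_le : {ae P, forall w, forall e, 0 < e ->
  \forall n \near \oo, orbit_int n%:R w <= (\int[P]_w g w + e) * n%:R}.
Proof.
have H (j : nat) : {ae P, forall w, ~ exceed (\int[P]_w g w + j.+1%:R^-1) w}.
  exists (exceed (\int[P]_w g w + j.+1%:R^-1)); split.
  - exact: measurable_exceed.
  - by apply: exceed_null; rewrite ltrDl.
  - by move=> w /= /contrapT.
apply: aeS (ae_foralln H) => w wN e e0.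
have [j je] : exists j : nat, j.+1%:R^-1 + j.+1%:R^-1 < e.
  have e20 : 0 < e / 2 by rewrite divr_gt0.
  have [j _ /(_ j (leqnn j))] := near_infty_natSinv_lt (PosNum e20).
  by move=> /= je; exists j; rewrite (splitr e) ltrD.
have := wN j; move/forallNP => /(_ j) /existsNP[N /forall2NP HN].
exists N => // n /= Nn.
have [//|/negP] := HN n; rewrite -ltNge => /ltW /le_trans; apply.
by rewrite ler_wpM2r// -addrA lerD2l ltW.
Qed.

End FlowAverages.

Section ErgodicTheorem.
Context {R : realType} d (Omega : measurableType d) (P : probability Omega R).
Local Notation mu := (@lebesgue_measure R).
Local Notation mR := (measurableTypeR R).

Lemma Rintegral_oppr (f : R -> R) (x y : R) : measurable_fun [set: mR] f ->
  (forall x, 0 <= f x) ->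
  \int[mu]_(t in `](- y), (- x)[) f t = \int[mu]_(t in `]x, y[) f (- t).
Proof.
move=> mf f0; rewrite /Rintegral; congr fine.
have mN : measurable_fun [set: mR] (fun t : mR => - t : mR) by exact: measurable_funN.
have mD : @measurable _ mR `](- y), (- x)[%classic by exact: measurable_itv.
have mEf : measurable_fun `](- y), (- x)[ (EFin \o f).
  by apply/measurable_EFinP; exact: measurable_funTS.
have := @ge0_integral_pushforward _ _ mR mR R _ mN mu _ (EFin \o f) mD mEf.
rewrite (_ : (fun t => - t) @^-1` `](- y), (- x)[ = `]x, y[%classic); last first.
  by apply/seteqP; split => t /=; rewrite !in_itv/= !ltrN2 andbC.
move=> <- //; last by move=> t _; rewrite lee_fin.
by apply: eq_measure_integral => A mA _; exact: (esym (lebesgue_measureN mA)).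
Qed.

Variable T : R -> Omega -> Omega.
Hypotheses (hT : measure_preserving_system P T) (hTerg : ergodic P T).
Variables (g : Omega -> R) (K : R).
Hypothesis mg : measurable_fun [set: Omega] g.
Hypothesis g0 : forall w, 0 <= g w.
Hypothesis gK : forall w, g w <= K.

Let mean : R := \int[P]_w g w.

Lemma mean_ge0 : 0 <= mean.
Proof. by apply: Rintegral_ge0 => w _. Qed.

(** The upper bound for K - g. *)
Lemma time_average_ge : {ae P, forall w, forall e, 0 < e ->
  \forall n \near \oo, (mean - e) * n%:R <= orbit_int T g n%:R w}.
Proof.
have mh : measurable_fun [set: Omega] (fun w => K - g w) by exact: measurable_funB.
have h0 w : 0 <= K - g w by rewrite subr_ge0.
have hK w : K - g w <= K by rewrite lerBlDr lerDl.
have := time_average_le hT mh h0 hK hTerg.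
have -> : \int[P]_w (K - g w) = K - mean.
  rewrite RintegralB//; last 2 first.
  - exact: (@bounded_integrable _ _ _ _ _ `|K|).
  - exact: (g_integrable P mg g0 gK).
  by rewrite Rintegral_cst//= probability_setT mulr1.
apply: aeS => w H e e0; have := H e e0; apply: filterS2 (nbhs_infty_gt 0%N) => n n0.
have -> : orbit_int T (fun w => K - g w) n%:R w = K * n%:R - orbit_int T g n%:R w.
  have n0R : (0 : R) < n%:R by rewrite ltr0n.
  rewrite /orbit_int RintegralB//; last 2 first.
  - by apply: continuous_integrable_oo; exact: cst_continuous.
  - exact: (integrable_orbit hT mg g0 gK).
  by rewrite (Rintegral_cst_itv n0R) subr0.
by rewrite lerBlDr addrC -lerBlDr -mulrBl; congr (_ * _ <= _); ring.
Qed.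

Lemma orbit_int_homo w : {homo (fun r => orbit_int T g r w) : x y / 0 <= x <= y >-> x <= y}.
Proof.
move=> x y /andP[x0 xy].
rewrite [leRHS]/orbit_int (Rintegral_split x0 xy (integrable_orbit hT mg g0 gK _ _ _)).
by rewrite lerDl; apply: Rintegral_ge0 => s _.
Qed.

(** The integral is monotone in r, so it is caught between its values at the two
integers next to r. *)
Lemma birkhoff_cvg : {ae P, forall w,
  r^-1 * \int[mu]_(s in `]0, r[) g (T s w) @[r --> +oo] --> mean}.
Proof.
apply: aeS2 (time_average_le hT mg g0 gK hTerg) time_average_ge => w Hle Hge.
apply/cvgrPdist_le => e e0.
have e20 : 0 < e / 2 by rewrite divr_gt0.
have [N1 _ HN1] := Hle _ e20; have [N2 _ HN2] := Hge _ e20.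
near=> r.
have r0 : 0 < r by near: r; exact: nbhs_pinfty_gt.
have /andP[nr rn] := Num.Theory.truncn_itv (ltW r0).
set n := Num.truncn r in nr rn.
have N1n : (N1 <= n)%N.
  rewrite -ltnS -(ltr_nat R); apply: le_lt_trans rn; near: r.
  by apply: nbhs_pinfty_ge; exact: num_real.
have N2n : (N2 <= n)%N.
  rewrite -ltnS -(ltr_nat R); apply: le_lt_trans rn; near: r.
  by apply: nbhs_pinfty_ge; exact: num_real.
have I1 : orbit_int T g r w <= (mean + e / 2) * (r + 1).
  apply: (@le_trans _ _ (orbit_int T g n.+1%:R w)).
    by apply: orbit_int_homo; rewrite !ltW.
  apply: (le_trans (HN1 n.+1 _)); first exact: leqW.
  rewrite ler_wpM2l//; first by rewrite addr_ge0 ?mean_ge0// ltW.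
  by rewrite -natr1 lerD2r.
have I2 : mean * (r - 1) - e / 2 * r <= orbit_int T g r w.
  apply: (@le_trans _ _ (orbit_int T g n%:R w)); last first.
    by apply: orbit_int_homo; rewrite ler0n.
  apply: le_trans (HN2 n N2n); rewrite mulrBl; apply: lerB.
    by rewrite ler_wpM2l ?mean_ge0// lerBlDr natr1 ltW.
  by rewrite ler_wpM2l// ltW.
have I3 : mean + e / 2 <= e / 2 * r.
  rewrite -ler_pdivrMl//; near: r; apply: nbhs_pinfty_ge; exact: num_real.
rewrite -/(orbit_int T g r w) distrC.
rewrite (_ : _ - _ = r^-1 * (orbit_int T g r w - mean * r)); last first.
  by field; rewrite gt_eqF.
rewrite normrM gtr0_norm ?invr_gt0// ler_pdivrMl//.
move: I1 I2 I3; rewrite (_ : (mean + e / 2) * (r + 1) = mean * r + e / 2 * r + (mean + e / 2)); last by ring.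
rewrite (_ : mean * (r - 1) = mean * r - mean); last by ring.
rewrite (_ : r * e = e / 2 * r + e / 2 * r); last by field.
have : 0 <= e / 2 by exact: ltW.
move: (orbit_int T g r w) (mean * r) (e / 2 * r) (e / 2) mean => i er x h E h0 i1 i2 i3.
rewrite ler_norml; apply/andP; split; lra.
Unshelve. all: by end_near. Qed.

End ErgodicTheorem.

Section TwoSided.
Context {R : realType} d (Omega : measurableType d) (P : probability Omega R).
Local Notation mu := (@lebesgue_measure R).
Local Notation mR := (measurableTypeR R).
Variable T : R -> Omega -> Omega.
Hypotheses (hT : measure_preserving_system P T) (hTerg : ergodic P T).

Let Tr (x : R) := T (- x).

Lemma reversed_system : measure_preserving_system P Tr.
Proof.
split.
- by move=> x; exact: (mps_measurable hT).
- by move=> x y; rewrite /Tr opprD (mps_add hT).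
- by rewrite /Tr oppr0 (mps_id hT).
- by move=> x F mF; exact: (mps_preserving hT).
- move=> d' X h mh.
  pose flip (p : mR * Omega) : mR * Omega := (- p.1, p.2).
  have mflip : measurable_fun [set: mR * Omega] flip.
    apply: measurable_fun_pair; last exact: measurable_snd.
    by apply: (measurable_funN (f := fst)); exact: measurable_fst.
  have mj : measurable_fun [set: mR * Omega] (fun p : mR * Omega => h (T p.1 p.2)).
    exact: (mps_joint hT mh).
  exact: (measurableT_comp mj mflip).
Qed.

Lemma reversed_ergodic : ergodic P Tr.
Proof.
move=> E [mE invE]; apply: hTerg; split => // x.
by rewrite -[in LHS](opprK x); exact: invE.
Qed.

Variables (g : Omega -> R) (K : R).
Hypothesis mg : measurable_fun [set: Omega] g.
Hypothesis g0 : forall w, 0 <= g w.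
Hypothesis gK : forall w, g w <= K.

(** Time reversal: the reversed flow preserves P and has the same invariant sets. *)
Lemma birkhoff_cvg_neg : {ae P, forall w,
  r^-1 * \int[mu]_(s in `](- r), 0[) g (T s w) @[r --> +oo] --> \int[P]_w g w}.
Proof.
apply: aeS (birkhoff_cvg reversed_system reversed_ergodic mg g0 gK) => w.
rewrite (_ : (fun r => r^-1 * \int[mu]_(s in `]0, r[) g (Tr s w)) =
   (fun r => r^-1 * \int[mu]_(s in `](- r), 0[) g (T s w)))//.
apply/funext => r; rewrite -(@Rintegral_oppr _ (fun s => g (T s w)) 0 r) ?oppr0//.
exact: (measurable_orbit hT mg w).
Qed.

(** Each time slice of the set of visits to N is null, so by Tonelli's theorem
almost every orbit spends zero time in N. *)
Lemma ae_orbit (N : set Omega) : measurable N -> P N = 0%E ->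
  {ae P, forall w, {ae mu, forall x, ~ N (T x w)}}.
Proof.
move=> mN N0.
have mi : measurable_fun [set: Omega] (\1_N : Omega -> R) by exact: measurable_indic.
have mj : measurable_fun [set: mR * Omega] (fun p : mR * Omega => (\1_N (T p.1 p.2) : R)%:E).
  by apply/measurable_EFinP; exact: (mps_joint hT mi).
have j0 (p : mR * Omega) : (0 <= (\1_N (T p.1 p.2) : R)%:E)%E by rewrite lee_fin.
have mvisit w : @measurable _ mR [set x | N (T x w)].
  rewrite -[X in measurable X]setTI.
  have mTw : measurable_fun [set: mR] (fun s : mR => T s w).
    have := @measurable_fun_pair1 _ _ _ mR Omega Omega (fun p : mR * Omega => T p.1 p.2) w.
    by apply; exact: (mps_joint hT (@measurable_id _ Omega setT)).
  exact: (mTw measurableT _ mN).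
have := fubini_tonelli (m1 := mu) (m2 := P) _ mj j0.
rewrite [LHS](_ : _ = 0%E); last first.
  rewrite integral0_eq// => s _ /=.
  rewrite (ge0_integral_preserving (mps_measurable hT s) (mps_preserving hT s) mi)//.
  by rewrite integral_indic// setIT.
have mG := measurable_fun_fubini_tonelli_G (m1 := mu) _ mj j0.
move=> /esym E.
have : (\int[P]_w `|fubini_G mu (fun p : mR * Omega => (\1_N (T p.1 p.2) : R)%:E) w| = 0)%E.
  rewrite -[RHS]E; apply: eq_integral => w _; rewrite gee0_abs//.
  by apply: integral_ge0 => s _; rewrite lee_fin.
move/(ae_eq_integral_abs P measurableT mG); apply: aeS => w /(_ I) Gw.
exists [set x | N (T x w)]; split; [exact: mvisit| |by move=> x /= /contrapT].
move: Gw; rewrite /fubini_G/=.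
have := @integral_indic _ _ _ mu setT measurableT _ (mvisit w).
rewrite setIT => <- <-; apply: eq_integral => s _.
by rewrite !indicE; congr (_%:R%:E); apply/idP/idP; rewrite !inE.
Qed.

End TwoSided.

(** * Almost sure homogenization *)

Section Clamp.
Context {R : realType}.

Lemma measurable_invr : measurable_fun [set: R] (fun x : R => x^-1).
Proof.
rewrite (_ : (fun x : R => x^-1) = (fun x => x * (x ^+ 2) `^ (-1))).
  apply: measurable_funM => //.
  apply: (measurableT_comp (f := fun x : R => x `^ (-1))); first exact: measurable_powR.
  exact: measurable_funX.
apply/funext => x; rewrite powR_inv1 ?sqr_ge0//.
have [->|x0] := eqVneq x 0; first by rewrite invr0 mul0r.
by rewrite expr2 invfM mulrA divff// mul1r.
Qed.

End Clamp.

Theorem theorem3 (R : realType) (d : measure_display) (Omega : measurableType d)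
    (P : probability Omega R) (T : R -> Omega -> Omega)
    (hT : measure_preserving_system P T) (hTerg : ergodic P T)
    (a : Omega -> R) (ha : measurable_fun [set: Omega] a)
    (nu1 nu2 : R) (hnu1 : 0 < nu1) (hnu2 : 0 < nu2)
    (hbounds : {ae P, forall omega, nu1 <= a omega <= nu2}) :
  {ae P, forall omega,
     let aT := fun x : R => a (T x omega) in
     admits_homogenization aT /\
     homogenized_coefficient aT (\int[P]_w (a w)^-1)%R^-1}.
Proof.
(* Clamping a between nu1 and nu2 changes it on a null set only. *)
pose g w := (Num.max nu1 (Num.min (a w) nu2))^-1.
pose k := Num.max nu1 nu2.
have k0 : 0 < k by rewrite lt_max hnu1.
have c0 w : 0 < Num.max nu1 (Num.min (a w) nu2) by rewrite lt_max hnu1.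
have ck w : Num.max nu1 (Num.min (a w) nu2) <= k.
  by rewrite /k ge_max !le_max !ge_min !lexx /= !orbT.
have gk w : k^-1 <= g w <= nu1^-1.
  by rewrite /g !lef_pV2 ?posrE// ck le_max lexx.
have g0 w : 0 <= g w by rewrite /g invr_ge0 ltW.
have gle w : g w <= nu1^-1 by have /andP[] := gk w.
have mg : measurable_fun [set: Omega] g.
  apply: (measurableT_comp measurable_invr).
  by apply: measurable_maxr => //; exact: measurable_minr.
have ga w : nu1 <= a w <= nu2 -> (a w)^-1 = g w.
  by move=> /andP[n1 n2]; rewrite /g (min_idPl n2) (max_idPr n1).
have -> : \int[P]_w (a w)^-1 = \int[P]_w g w.
  apply: ae_eq_Rintegral => //; first exact: (measurableT_comp measurable_invr).
  by apply: aeS hbounds => w /ga.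
have m0 : 0 < \int[P]_w g w.
  apply: (@lt_le_trans _ _ (\int[P]_w k^-1)).
    by rewrite Rintegral_cst//= probability_setT mulr1 invr_gt0.
  apply: le_Rintegral => //.
  - exact: (@bounded_integrable _ _ _ _ _ `|k^-1|).
  - exact: (g_integrable P mg g0 gle).
  - by move=> w _; have /andP[] := gk w.
have [A [mA A0 subA]] := hbounds.
apply: aeS3 (birkhoff_cvg hT hTerg mg g0 gle) (birkhoff_cvg_neg hT hTerg mg g0 gle)
  (ae_orbit hT mA A0) => w Hpos Hneg HA.
set aT := fun x : R => a (T x w).
suff H : homogenized_coefficient aT (\int[P]_w g w)^-1.
  by split => //; exists (\int[P]_w g w)^-1.
have kV0 : 0 < k^-1 by rewrite invr_gt0.
apply: (@homogenization_of_mean R aT (fun x => g (T x w)) _ (k^-1) (nu1^-1)) => //.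
- exact: (measurable_orbit hT ha).
- exact: (measurable_orbit hT mg).
- apply: aeS HA => x xA.
  have H : nu1 <= a (T x w) <= nu2 by apply: contrapT => N; apply: xA; exact: subA.
  by rewrite -(ga _ H) invrK.
Qed.
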